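(* Suppose Assumptions 1 and 2 hold, $\bar\xi_0\in\Xi_0$, and consider the extensive problem $\mathrm{EP}(0,\infty,\mathbf 0)$ on the canonical scenario tree (i.e. $\bar w=0$). Then it has a unique primal-dual solution $\underline{\mathbf z}^\star=\{\underline z^\star_i\}_{i\in\mathcal V}$, and there exist block matrices $\underline{\boldsymbol\Omega}^\star=\{\underline\Omega^\star_{ij}\}_{i,j\in\mathcal V}$ and $\underline{\boldsymbol\Psi}^\star=\{\underline\Psi^\star_{ij}\}_{i,j\in\mathcal V}$ with $\underline{\mathbf z}^\star=\underline{\boldsymbol\Omega}^\star\underline{\mathbf p}$ and $\underline{\mathbf w}^\star=\underline{\boldsymbol\Psi}^\star\underline{\mathbf p}$, such that for all $t,t'\in\mathcal T$, $$\|\underline{\boldsymbol\Omega}^\star_{\mathcal V_t,\mathcal V_{t'}}\|_\pi\vee\|\underline{\boldsymbol\Psi}^\star_{\mathcal V_t,\mathcal V_{t'}}\|_\pi\le c_1\rho^{|t-t'|}.$$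
   Context: Setting. $\mathcal T=\{0,\dots,T\}$, $\mathcal T_{a:b}=\mathcal T\cap\{a,\dots,b\}$ (equal to $\mathcal T_{a:T}$ if $b>T$ or $b=\infty$); $\boldsymbol\xi=(\xi_0,\dots,\xi_T)$ a stochastic process in a measurable set $\Xi$; $\boldsymbol\xi_{0:t}=(\xi_0,\dots,\xi_t)$; data functions $A,B,d,Q,R,q,r$ on $\Xi$ valued in $\mathbb R^{n_x\times n_x},\mathbb R^{n_x\times n_u},\mathbb R^{n_x},\mathbb S_{n_x},\mathbb S_{n_u},\mathbb R^{n_x},\mathbb R^{n_u}$; for $w=[x;u]$: $f(w;\xi)=A(\xi)x+B(\xi)u+d(\xi)$, $\ell(w;\xi)=\tfrac12x^\top Q(\xi)x+\tfrac12u^\top R(\xi)u-q(\xi)^\top x-r(\xi)^\top u$, $p(\xi)=[q(\xi);r(\xi);d(\xi)]$. Assumption 1: $\boldsymbol\xi$ has finite support. Assumption 2: there exist $L\ge1$, $\alpha\in(0,1)$, $\gamma\in(0,1]$ such that (a) $\|A(\xi_t)\|,\|B(\xi_t)\|,\|Q(\xi_t)\|,\|R(\xi_t)\|\le L$ a.s.; (b) $Q(\xi_t)\succeq0$, $R(\xi_t)\succeq\gamma I$ a.s.; (c) there are $K_t(\boldsymbol\xi_{0:t})$, $t\in\mathcal T_{0:T-1}$ (functions of $\boldsymbol\xi_{0:t}$ only), $\|K_t\|\le L$ a.s., such that $\|\Phi_{t''}\cdots\Phi_{t'+1}\|\le L\alpha^{t''-t'}$ a.s. for all $t'<t''$ in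 $\mathcal T$ with $\Phi_t=A(\xi_t)-B(\xi_t)K_{t-1}(\boldsymbol\xi_{0:t-1})$; (d) there are $K'_t(\boldsymbol\xi_{0:t})$, $t\in\mathcal T_{1:T}$, $\|K'_t\|\le L$ a.s., such that the same holds with $\Phi_t=A(\xi_t)-K'_t(\boldsymbol\xi_{0:t})Q(\xi_{t-1})^{1/2}$. Canonical scenario tree (given $\bar\xi_0$): $\mathcal V=\bigcup_{t\in\mathcal T}\{\boldsymbol\zeta_{0:t}$ in the support of $\boldsymbol\xi_{0:t}$ with $\zeta_0=\bar\xi_0\}$; node $i=\boldsymbol\zeta_{0:t}$ has stage $t(i)=t$, parent $a(i)=\boldsymbol\zeta_{0:t-1}$, realization $\underline\xi_i=\zeta_t$, probability $\pi_i=\mathbb P[\boldsymbol\xi_{0:t}=\boldsymbol\zeta_{0:t}\mid\xi_0=\bar\xi_0]$; root $0=(\bar\xi_0)$; $\pi_{i|k}=\pi_i/\pi_k$; $\mathcal V_t$ nodes at stage $t$; $\mathcal V^{(k)}_t$ descendants of $k$ (nodes having $k$ as initial segment, including $k$) at stage $t$, $\mathcal V^{(k)}_{a:b}=\bigcup_{t\in\mathcal T_{a:b}}\mathcal V^{(k)}_t$. $\underline p_i=p(\underline\xi_i)$, $\underline{\mathbf p}=\{\underline p_i\}_{i\in\mathcal V}$. Extensive problem $\mathrm{EP}(k,W,\bar w)$ for $k\in\mathcal V$, $\tau=t(k)$, $W\in\mathbb Z_{\ge0}\cup\{\infty\}$, $\bar w\in\mathbb R^{n_x}\times\mathbb R^{n_u}$: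 minimize $\sum_{i\in\mathcal V^{(k)}_{\tau:\tau+W}}\pi_{i|k}\ell(\underline w_i;\underline\xi_i)$ over $\underline w_i=[\underline x_i;\underline u_i]$ subject to $\underline x_k=f(\bar w;\underline\xi_k)$ (multiplier $\underline y_k$) and $\pi_{i|k}\underline x_i=\pi_{i|k}f(\underline w_{a(i)};\underline\xi_i)$ (multiplier $\underline y_i$) for $i\in\mathcal V^{(k)}_{\tau+1:\tau+W}$. Primal-dual variables $\underline z_i=[\underline w_i;\underline y_i]$. Scaled norm: for block matrix $\mathbf M$ and $\mathcal V',\mathcal V''\subseteq\mathcal V$, $\|\mathbf M_{\mathcal V',\mathcal V''}\|_\pi=\max\{\|\{\pi_i^{1/2}(\mathbf M\mathbf v)_i\}_{i\in\mathcal V'}\|:\|\{\pi_j^{1/2}v_j\}_{j\in\mathcal V''}\|\le1\}$, where $\mathbf M_{\mathcal V',\mathcal V''}=\{M_{ij}\}_{i\in\mathcal V',j\in\mathcal V''}$. Constants: $L_H=2L+1$, $\gamma_F=\frac{(1-\alpha)^2}{(1+L)^2L^2}$, $\gamma_G=\frac{\gamma(1-\alpha)^2}{2(1+L)^2L^4}$, $\bar\mu=\frac{2L_H^2/\gamma_G+\gamma_G+L_H}{\gamma_F}$, $\gamma_H=\Big(\frac2{\gamma_G}+\big(1+\frac{4L_H}{\gamma_G}+\frac{4L_H^2}{\gamma_G^2}\big)\frac{L_H(1+\bar\mu L_H)}{\gamma_F}+\bar\mu\Big)^{-1}$, $\rho=\big(\frac{L_H^2-\gamma_H^2}{L_H^2+\gamma_H^2}\big)^{1/2}$,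 $c_1=\frac{L_H}{\gamma_H^2\rho}$. $a\vee b=\max(a,b)$. *)

(* Defs.v *)
From HB Require Import structures.
From mathcomp Require Import all_boot all_order all_algebra.
From mathcomp Require Import classical_sets reals.
Set Implicit Arguments. Unset Strict Implicit. Unset Printing Implicit Defensive.
Import Order.TTheory GRing.Theory Num.Theory.
Local Open Scope ring_scope.
Local Open Scope classical_set_scope.

Section Defs.
Variable R : realType.

Definition vdot (n : nat) (v w : 'cV[R]_n) : R := \sum_(i < n) v i 0 * w i 0.
Definition vnorm2 (n : nat) (v : 'cV[R]_n) : R := vdot v v.
Definition vnorm (n : nat) (v : 'cV[R]_n) : R := Num.sqrt (vnorm2 v).

Definition opnorm (m n : nat) (M : 'M[R]_(m, n)) : R :=
  sup [set c | exists v : 'cV[R]_n, vnorm v <= 1 /\ c = vnorm (M *m v)].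

Definition sym_mx (n : nat) (M : 'M[R]_n) : Prop := M^T = M.
Definition psd_ge (n : nat) (g : R) (M : 'M[R]_n) : Prop :=
  forall v : 'cV[R]_n, g * vnorm2 v <= vdot v (M *m v).

Definition prodPhi (n : nat) (Phi : nat -> 'M[R]_n) (a b : nat) : 'M[R]_n :=
  \big[mulmx/1%:M]_(k <- rev (index_iota a.+1 b.+1)) Phi k.

Definition tdist (t t' : nat) : nat := if (t <= t')%N then (t' - t)%N else (t - t')%N.

Section Constants.
Variables (L alpha gamma : R).
Definition L_H : R := 2 * L + 1.
Definition gamma_F : R := (1 - alpha) ^+ 2 / ((1 + L) ^+ 2 * L ^+ 2).
Definition gamma_G : R := gamma * (1 - alpha) ^+ 2 / (2 * (1 + L) ^+ 2 * L ^+ 4).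
Definition mu_bar : R := (2 * L_H ^+ 2 / gamma_G + gamma_G + L_H) / gamma_F.
Definition gamma_H : R :=
  (2 / gamma_G
   + (1 + 4 * L_H / gamma_G + 4 * L_H ^+ 2 / gamma_G ^+ 2)
       * (L_H * (1 + mu_bar * L_H) / gamma_F)
   + mu_bar)^-1.
Definition rho : R := Num.sqrt ((L_H ^+ 2 - gamma_H ^+ 2) / (L_H ^+ 2 + gamma_H ^+ 2)).
Definition c_1 : R := L_H / (gamma_H ^+ 2 * rho).
End Constants.

(** Scenario tree.  The law of (xi_0,...,xi_T) is finitely supported
    (Assumption 1): it is given by its support [S] (a list of distinct
    paths, each a sequence of length T+1) and the positive masses [mu].
    A node is a prefix (zeta_0,...,zeta_t) (a nonempty sequence). *)
Section Tree.
Variable Xi : choiceType.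
Variables (T : nat) (S : seq (seq Xi)) (mu : seq Xi -> R) (xb0 : Xi).

Definition P0 : R := \sum_(s <- S | head xb0 s == xb0) mu s.

Definition nodes : seq (seq Xi) :=
  undup [seq take t.+1 s | s <- [seq s <- S | head xb0 s == xb0], t <- iota 0 T.+1].
Definition nodes_at (t : nat) : seq (seq Xi) := [seq i <- nodes | size i == t.+1].
Definition root : seq Xi := [:: xb0].
Definition parent (i : seq Xi) : seq Xi := take (size i).-1 i.
Definition realization (i : seq Xi) : Xi := last xb0 i.
(** pi_i = P[xi_(0:t) = i | xi_0 = xb0] *)
Definition piN (i : seq Xi) : R :=
  (\sum_(s <- S | take (size i) s == i) mu s) / P0.
End Tree.

Definition fam_norm (I : Type) (pi : I -> R) (k : nat) (W : seq I) (v : I -> 'cV[R]_k) : R :=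
  Num.sqrt (\sum_(i <- W) pi i * vnorm2 (v i)).
Definition pinorm (I : Type) (pi : I -> R) (m k : nat) (M : I -> I -> 'M[R]_(m, k))
    (V1 V2 : seq I) : R :=
  sup [set c | exists v : I -> 'cV[R]_k,
         fam_norm pi V2 v <= 1 /\
         c = fam_norm pi V1 (fun i => \sum_(j <- V2) M i j *m v j)].

Section Problem.
Variables (Xi : Type) (nx nu : nat).
Variables (A : Xi -> 'M[R]_nx) (B : Xi -> 'M[R]_(nx, nu)) (d : Xi -> 'cV[R]_nx)
          (Q : Xi -> 'M[R]_nx) (Rm : Xi -> 'M[R]_nu)
          (q : Xi -> 'cV[R]_nx) (r : Xi -> 'cV[R]_nu).

Definition fdyn (xi : Xi) (x : 'cV[R]_nx) (u : 'cV[R]_nu) : 'cV[R]_nx :=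
  A xi *m x + B xi *m u + d xi.
Definition stage_cost (xi : Xi) (x : 'cV[R]_nx) (u : 'cV[R]_nu) : R :=
  2^-1 * vdot x (Q xi *m x) + 2^-1 * vdot u (Rm xi *m u) - vdot (q xi) x - vdot (r xi) u.
Definition pdata (xi : Xi) : 'cV[R]_(nx + nu + nx) := col_mx (col_mx (q xi) (r xi)) (d xi).
End Problem.

Section EP.
Variables (Xi : choiceType) (nx nu : nat).
Variables (A : Xi -> 'M[R]_nx) (B : Xi -> 'M[R]_(nx, nu)) (d : Xi -> 'cV[R]_nx)
          (Q : Xi -> 'M[R]_nx) (Rm : Xi -> 'M[R]_nu)
          (q : Xi -> 'cV[R]_nx) (r : Xi -> 'cV[R]_nu).
Variables (T : nat) (S : seq (seq Xi)) (mu : seq Xi -> R) (xb0 : Xi).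

Let V := nodes T S xb0.
Let pi := piN S mu xb0.
Let xi_ := realization xb0.

Definition EP_lagrangian (x : seq Xi -> 'cV[R]_nx) (u : seq Xi -> 'cV[R]_nu)
    (y : seq Xi -> 'cV[R]_nx) : R :=
  \sum_(i <- V) pi i * stage_cost Q Rm q r (xi_ i) (x i) (u i)
  + vdot (y (root xb0)) (fdyn A B d xb0 0 0 - x (root xb0))
  + \sum_(i <- V | i != root xb0)
      vdot (y i) (pi i *: fdyn A B d (xi_ i) (x (parent i)) (u (parent i)) - pi i *: x i).

(** primal-dual solution = saddle point of the Lagrangian
    (min over w, max over y) *)
Definition EP_primal_dual_sol (x : seq Xi -> 'cV[R]_nx) (u : seq Xi -> 'cV[R]_nu)
    (y : seq Xi -> 'cV[R]_nx) : Prop :=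
  (forall y', EP_lagrangian x u y' <= EP_lagrangian x u y) /\
  (forall x' u', EP_lagrangian x u y <= EP_lagrangian x' u' y).
End EP.

End Defs.

(* Main.v *)
Require Import Defs.
From HB Require Import structures.
From mathcomp Require Import all_boot all_order all_algebra.
From mathcomp Require Import classical_sets reals.
From mathcomp Require Import ring lra zify.
Set Implicit Arguments. Unset Strict Implicit. Unset Printing Implicit Defensive.
Import Order.TTheory GRing.Theory Num.Theory.
Local Open Scope ring_scope.

(** In the inner product weighted by the node probabilities, the optimality
conditions of the extensive problem read [H z = (q, r, - d)] with a self-adjoint
operator [H] that couples a node only with its parent and its children.
Stabilizability solves the dynamics with a bounded right inverse, detectability
makes the cost coercive on the kernel of the dynamics, and together they give
[gamma_H |z| <= |H z| <= L_H |z|]; in particular [H] is invertible.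
For the decay, [M = 1 - c H^2] with [c = 2 / (L_H^2 + gamma_H^2)] has norm at most
[rho^2] and propagates by at most two stages.  If [H z = p] and [p] lives on stage
[t'], then [z - M^n z] vanishes at distance [2 n] or more from [t'], so that [z]
restricted to such a stage has norm at most [rho^(2 n) |p| / gamma_H]. *)

(** * Inner products *)

(** The obstacle is the branching: norm bounds along single scenarios must become bounds on families
    whose size grows with the stage. In the weighted product the shift from parent to child has norm
    at most one, since the children of a node weigh together at most what the node weighs. Every
    estimate then costs the same as on one scenario, whatever the number of branches. The adjoint of
    the shift is a conditional expectation, so the weights in the constraints are exactly what makes
    [H] self-adjoint.

    [H] is in general indefinite, because multipliers enter linearly, so [1 - c H] cannot be
    expected to contract. The form of [H^2] lies between [gamma_H^2] and [L_H^2], and [c] is the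
    reciprocal of the midpoint of this interval.

    No limit is taken anywhere. The recursions along the tree are nilpotent, the space of families
    is finite dimensional, so that injectivity gives the inverse, and the series for the inverse
    enters only through its remainder. *)

Lemma linear_mulmx (R : comNzRingType) m n (f : 'cV[R]_n -> 'cV[R]_m) : linear f ->
  forall v, (\matrix_(a, b) f (delta_mx b 0) a 0) *m v = f v.
Proof.
move=> f_lin v.
pose F : {linear 'cV[R]_n -> 'cV[R]_m} :=
  HB.pack f (GRing.isLinear.Build R 'cV[R]_n 'cV[R]_m *:%R f f_lin).
rewrite [v in RHS]matrix_sum_delta -[f]/(F : _ -> _) linear_sum.
apply/matrixP => i k; rewrite ord1 !mxE summxE; apply: eq_bigr => j _.
by rewrite big_ord1 linearZ !mxE mulrC.
Qed.

Section InnerProduct.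
Variable R : realType.

Record inner_product (V : lmodType R) (ip : V -> V -> R) : Prop := InnerProduct {
  ipC : forall u v, ip u v = ip v u;
  ipDl : forall u v w, ip (u + v) w = ip u w + ip v w;
  ipZl : forall a u v, ip (a *: u) v = a * ip u v;
  ip_ge0 : forall u, 0 <= ip u u;
  ip_def : forall u, ip u u = 0 -> u = 0 }.

Definition ipnorm (V : lmodType R) (ip : V -> V -> R) (v : V) : R :=
  Num.sqrt (ip v v).

Section Theory.
Variables (V : lmodType R) (ip : V -> V -> R).
Hypothesis ipV : inner_product ip.
Local Notation "<( u , v )>" := (ip u v) (format "<( u ,  v )>").
Local Notation N := (ipnorm ip).

Lemma ipDr u v w : <(w, u + v)> = <(w, u)> + <(w, v)>.
Proof. by rewrite (ipC ipV) (ipDl ipV) !(ipC ipV w). Qed.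

Lemma ipZr a u v : <(u, a *: v)> = a * <(u, v)>.
Proof. by rewrite (ipC ipV) (ipZl ipV) (ipC ipV u). Qed.

Lemma ipNl u v : <(- u, v)> = - <(u, v)>.
Proof. by rewrite -scaleN1r (ipZl ipV) mulN1r. Qed.

Lemma ipNr u v : <(u, - v)> = - <(u, v)>.
Proof. by rewrite -scaleN1r ipZr mulN1r. Qed.

Lemma ip0l v : <(0, v)> = 0.
Proof. by rewrite -(scale0r v) (ipZl ipV) mul0r. Qed.

Lemma ip0r v : <(v, 0)> = 0.
Proof. by rewrite (ipC ipV) ip0l. Qed.

Lemma ipnorm_ge0 v : 0 <= N v. Proof. exact: sqrtr_ge0. Qed.

Lemma ipnorm_sqr v : N v ^+ 2 = <(v, v)>.
Proof. by rewrite sqr_sqrtr // (ip_ge0 ipV). Qed.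

Lemma ipnorm0 : N 0 = 0.
Proof. by rewrite /ipnorm ip0l sqrtr0. Qed.

Lemma ipnorm_eq0 v : N v = 0 -> v = 0.
Proof. by move=> Nv; apply: (ip_def ipV); rewrite -ipnorm_sqr Nv expr0n. Qed.

Lemma ipnormN v : N (- v) = N v.
Proof. by rewrite /ipnorm ipNl ipNr opprK. Qed.

Lemma ipnormZ a v : N (a *: v) = `|a| * N v.
Proof.
rewrite /ipnorm (ipZl ipV) ipZr mulrA -expr2 sqrtrM ?sqr_ge0 //.
by rewrite sqrtr_sqr.
Qed.

Lemma cauchy_schwarz u v : <(u, v)> <= N u * N v.
Proof.
have [Nv0|Nv0] := eqVneq (N v) 0.
  by rewrite (ipnorm_eq0 Nv0) ip0r ipnorm0 mulr0.
have [Nu0|Nu0] := eqVneq (N u) 0.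
  by rewrite (ipnorm_eq0 Nu0) ip0l ipnorm0 mul0r.
have Nup : 0 < N u by rewrite lt_def Nu0 ipnorm_ge0.
have Nvp : 0 < N v by rewrite lt_def Nv0 ipnorm_ge0.
have := ip_ge0 ipV (N v *: u - N u *: v).
rewrite (ipDl ipV) !ipDr !ipNl !ipNr !(ipZl ipV) !ipZr (ipC ipV v u).
rewrite -!ipnorm_sqr => h.
have : 0 <= 2 * (N u * N v) * (N u * N v - <(u, v)>) by nra.
by rewrite pmulr_rge0 ?subr_ge0 // !mulr_gt0.
Qed.

Lemma cauchy_schwarz_abs u v : `|<(u, v)>| <= N u * N v.
Proof.
rewrite ler_norml cauchy_schwarz andbT lerNl -ipNl.
by rewrite (le_trans (cauchy_schwarz _ _)) // ipnormN.
Qed.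

Lemma ipnorm_le c v : 0 <= c -> <(v, v)> <= c ^+ 2 -> N v <= c.
Proof. by move=> c0 h; rewrite -(ger0_norm c0) -sqrtr_sqr ler_sqrt ?sqr_ge0. Qed.

Lemma ipnormD u v : N (u + v) <= N u + N v.
Proof.
apply: ipnorm_le; first by rewrite addr_ge0 ?ipnorm_ge0.
rewrite (ipDl ipV) !ipDr -!ipnorm_sqr (ipC ipV v u).
by have := cauchy_schwarz u v; lra.
Qed.

Lemma ipnormB u v : N (u - v) <= N u + N v.
Proof. by rewrite (le_trans (ipnormD _ _)) // ipnormN. Qed.

Lemma ipnorm_sum (I : Type) (r : seq I) (F : I -> V) :
  N (\sum_(i <- r) F i) <= \sum_(i <- r) N (F i).
Proof.
elim/big_rec2: _ => [|i x v _ h]; first by rewrite ipnorm0.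
by rewrite (le_trans (ipnormD _ _)) // lerD2l.
Qed.

(* Polarization turns the bound on the quadratic form into a bound on the
   bilinear form, which is then evaluated at [M v / r] and [v]. *)
Lemma selfadjoint_norm_le (M : {linear V -> V}) (r : R) : 0 < r ->
  (forall u v, <(M u, v)> = <(u, M v)>) ->
  (forall v, `|<(v, M v)>| <= r * <(v, v)>) ->
  forall v, N (M v) <= r * N v.
Proof.
move=> r0 Msym Mr v.
apply: ipnorm_le; first by rewrite mulr_ge0 ?ipnorm_ge0 // ltW.
rewrite exprMn.
set w := M v; set u := r^-1 *: w.
have := Mr (u - v); have := Mr (u + v).
rewrite !ler_norml => /andP[_ h1] /andP[h2 _].
move: h1 h2; rewrite !raddfD !raddfN.
rewrite !(ipDl ipV) !ipDr !ipNl !ipNr.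
rewrite -[<(v, M u)>]Msym -[M v]/w (ipC ipV v u).
have -> : <(w, u)> = r^-1 * <(w, w)> by rewrite ipZr.
have -> : <(u, w)> = r^-1 * <(w, w)> by rewrite (ipZl ipV).
have -> : <(u, u)> = r^-1 * (r^-1 * <(w, w)>) by rewrite (ipZl ipV) ipZr.
set a := <(w, w)>; set b := <(v, v)> => h1 h2.
have h3 : r^-1 * a <= r * b.
  have -> : r * b = 2^-1 * (r * (2 * b + 2 * (r^-1 * (r^-1 * a)))) - r^-1 * a.
    by field; rewrite gt_eqF.
  by lra.
have : r * (r^-1 * a) <= r * (r * b) by rewrite ler_pM2l.
by rewrite mulVKf ?gt_eqF // mulrA -expr2 ipnorm_sqr.
Qed.

End Theory.

Lemma inner_product_pair (U V : lmodType R) (ipU : U -> U -> R) (ipV : V -> V -> R) :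
  inner_product ipU -> inner_product ipV ->
  inner_product (fun a b : U * V => ipU a.1 b.1 + ipV a.2 b.2).
Proof.
move=> hU hV; split=> [u v|u v w|a u v|u|u] /=.
- by rewrite (ipC hU) (ipC hV).
- by rewrite (ipDl hU) (ipDl hV) addrACA.
- by rewrite (ipZl hU) (ipZl hV) mulrDr.
- by rewrite addr_ge0 ?(ip_ge0 hU) ?(ip_ge0 hV).
move: (ip_ge0 hU u.1) (ip_ge0 hV u.2) => h1 h2 h.
have /(ip_def hU) u1 : ipU u.1 u.1 = 0 by lra.
have /(ip_def hV) u2 : ipV u.2 u.2 = 0 by lra.
by rewrite [u]surjective_pairing u1 u2.
Qed.

Lemma inner_product_vdot n : inner_product (@vdot R n).
Proof.
split=> [u v|u v w|a u v|u|u].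
- by apply: eq_bigr => i _; rewrite mulrC.
- by rewrite -big_split; apply: eq_bigr => i _; rewrite mxE mulrDl.
- by rewrite mulr_sumr; apply: eq_bigr => i _; rewrite mxE mulrA.
- by apply: sumr_ge0 => i _; rewrite -expr2 sqr_ge0.
move=> u0; apply/matrixP => i j; rewrite ord1 mxE.
have/psumr_eq0P/(_ u0 i erefl)/eqP : forall i, true -> 0 <= u i 0 * u i 0.
  by move=> k _; rewrite -expr2 sqr_ge0.
by rewrite mulf_eq0 orbb => /eqP.
Qed.

Lemma vdotE m (u v : 'cV[R]_m) : vdot u v = (u^T *m v) 0 0.
Proof. by rewrite mxE; apply: eq_bigr => i _; rewrite mxE. Qed.

Lemma vdot_adj m n (M : 'M[R]_(m, n)) u v : vdot (M *m u) v = vdot u (M^T *m v).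
Proof. by rewrite !vdotE trmx_mul mulmxA. Qed.

Lemma vnorm2_sqr n (v : 'cV[R]_n) : vnorm v ^+ 2 = vnorm2 v.
Proof. exact: (ipnorm_sqr (inner_product_vdot n)). Qed.

Lemma vnorm_ge0 n (v : 'cV[R]_n) : 0 <= vnorm v.
Proof. exact: sqrtr_ge0. Qed.

Lemma vnorm2_ge0 n (v : 'cV[R]_n) : 0 <= vnorm2 v.
Proof. exact: (ip_ge0 (inner_product_vdot n)). Qed.

Lemma vnorm2_col_mx m n (u : 'cV[R]_m) (v : 'cV[R]_n) :
  vnorm2 (col_mx u v) = vnorm2 u + vnorm2 v.
Proof.
rewrite /vnorm2 /vdot big_split_ord; congr (_ + _); apply: eq_bigr => i _.
  by rewrite col_mxEu.
by rewrite col_mxEd.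
Qed.

(** Cauchy-Schwarz on each row gives the Frobenius norm as a bound. Without a bound the [sup] in
    [opnorm] would carry no information. *)
Lemma opnorm_has_ubound m n (M : 'M[R]_(m, n)) :
  has_ubound [set c | exists v : 'cV[R]_n, vnorm v <= 1 /\ c = vnorm (M *m v)]%classic.
Proof.
pose f i := vnorm (row i M)^T.
exists (Num.sqrt (\sum_i f i ^+ 2)) => _ [v [v1 ->]].
have h i : `|(M *m v) i 0| <= f i.
  have -> : (M *m v) i 0 = vdot (row i M)^T v.
    by rewrite mxE; apply: eq_bigr => j _; rewrite !mxE.
  apply: le_trans (cauchy_schwarz_abs (inner_product_vdot n) _ _) _.
  by rewrite -[leRHS]mulr1 ler_wpM2l ?vnorm_ge0.
rewrite ler_sqrt; last by apply: sumr_ge0 => i _; rewrite sqr_ge0.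
apply: ler_sum => i _; rewrite -expr2 -[leLHS]real_normK ?num_real //.
by rewrite lerXn2r ?nnegrE // ?vnorm_ge0.
Qed.

Lemma vnorm_mulmx m n (M : 'M[R]_(m, n)) v : vnorm (M *m v) <= opnorm M * vnorm v.
Proof.
have ipV := inner_product_vdot n; have ipV' := inner_product_vdot m.
have [v0|v0] := eqVneq (vnorm v) 0.
  by rewrite v0 (ipnorm_eq0 ipV v0) mulmx0 mulr0 [vnorm _](ipnorm0 ipV').
have vp : 0 < vnorm v by rewrite lt_def v0 vnorm_ge0.
rewrite -ler_pdivrMr // mulrC.
have {1}-> : (vnorm v)^-1 = `|(vnorm v)^-1| by rewrite gtr0_norm ?invr_gt0.
rewrite -[_ * _](ipnormZ ipV').
apply: ub_le_sup; first exact: opnorm_has_ubound.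
exists ((vnorm v)^-1 *: v); split; last by rewrite -scalemxAr.
by rewrite [vnorm _](ipnormZ ipV) gtr0_norm ?invr_gt0 // -[ipnorm _ v]/(vnorm v) mulVf.
Qed.

Lemma vnorm_mulmx_le m n (M : 'M[R]_(m, n)) c v :
  opnorm M <= c -> vnorm (M *m v) <= c * vnorm v.
Proof. by move=> Mc; rewrite (le_trans (vnorm_mulmx M v)) ?ler_wpM2r ?vnorm_ge0. Qed.

(** In finite dimension a trivial kernel is enough, so a lower norm bound alone yields
    solvability. *)
Lemma injective_linear_inverse (V : vectType R) (f : {linear V -> V}) :
  injective f -> exists g : {linear V -> V}, cancel g f.
Proof.
move=> f_inj.
have kf : lker (linfun f) == 0%VS by apply/lker0P => u v; rewrite !lfunE => /f_inj.
exists ((linfun f)^-1)%VF => v.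
by rewrite -[LHS](lfunE f) lker0_lfunVK.
Qed.

End InnerProduct.

(** * Families indexed by a weighted tree *)

Section Family.
Variables (R : realType) (I : finType) (pi : I -> R).
Hypothesis pi_gt0 : forall i, 0 < pi i.

Definition fam_ip n (x y : {ffun I -> 'cV[R]_n}) : R := \sum_i pi i * vdot (x i) (y i).

Lemma inner_product_fam n : inner_product (@fam_ip n).
Proof.
have hv := inner_product_vdot R n.
split=> [u v|u v w|a u v|u|u].
- by apply: eq_bigr => i _; rewrite (ipC hv).
- by rewrite -big_split; apply: eq_bigr => i _; rewrite ffunE (ipDl hv) mulrDr.
- by rewrite mulr_sumr; apply: eq_bigr => i _; rewrite ffunE (ipZl hv) mulrCA.
- by apply: sumr_ge0 => i _; rewrite mulr_ge0 ?(ip_ge0 hv) // ltW.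
move=> u0; apply/ffunP => i; rewrite ffunE; apply: (ip_def hv).
have/psumr_eq0P/(_ u0 i erefl)/eqP : forall i, true -> 0 <= pi i * vdot (u i) (u i).
  by move=> k _; rewrite mulr_ge0 ?(ip_ge0 hv) // ltW.
by rewrite mulf_eq0 gt_eqF //= => /eqP.
Qed.

Definition mulf m n (M : I -> 'M[R]_(m, n)) (x : {ffun I -> 'cV[R]_n}) :
  {ffun I -> 'cV[R]_m} := [ffun i => M i *m x i].

Lemma mulf_linear m n (M : I -> 'M[R]_(m, n)) : linear (mulf M).
Proof.
by move=> a x y; apply/ffunP => i; rewrite !ffunE mulmxDr scalemxAr.
Qed.

HB.instance Definition _ m n M :=
  GRing.isLinear.Build R {ffun I -> 'cV[R]_n} {ffun I -> 'cV[R]_m} *:%R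
    (@mulf m n M) (mulf_linear M).

Lemma mulf_adj m n (M : I -> 'M[R]_(m, n)) x y :
  fam_ip (mulf M x) y = fam_ip x (mulf (fun i => (M i)^T) y).
Proof. by apply: eq_bigr => i _; rewrite !ffunE vdot_adj. Qed.

Lemma fam_norm_mulf_le m n (M : I -> 'M[R]_(m, n)) c x : 0 <= c ->
  (forall i v, vnorm (M i *m v) <= c * vnorm v) ->
  ipnorm (@fam_ip m) (mulf M x) <= c * ipnorm (@fam_ip n) x.
Proof.
move=> c0 Mc; apply: ipnorm_le; first by rewrite mulr_ge0 ?ipnorm_ge0.
rewrite exprMn (ipnorm_sqr (inner_product_fam n)) mulr_sumr.
apply: ler_sum => i _; rewrite ffunE mulrCA ler_pM2l //.
rewrite -![vdot _ _]/(vnorm2 _) -!vnorm2_sqr -exprMn lerXn2r ?nnegrE ?Mc ?vnorm_ge0 //.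
by rewrite mulr_ge0 ?vnorm_ge0.
Qed.

(** * Shifts and linear recursions along the tree *)

Section Tree.
Variables (root : I) (par : I -> I) (st : I -> nat).
Hypothesis st_par : forall i, i != root -> st i = (st (par i)).+1.
Hypothesis pi_children : forall k, \sum_(i | (i != root) && (par i == k)) pi i <= pi k.

(** The zero at the root stands for the missing predecessor; it encodes the initial datum [0] of the
    extensive problem. *)
Definition lift n (x : {ffun I -> 'cV[R]_n}) : {ffun I -> 'cV[R]_n} :=
  [ffun i => if i == root then 0 else x (par i)].

(** Adjoint of [lift]. The ratio [pi i / pi k] is the conditional probability of the child [i] given
    [k], so this is a conditional expectation over the next stage. *)
Definition liftT n (y : {ffun I -> 'cV[R]_n}) : {ffun I -> 'cV[R]_n} :=
  [ffun k => \sum_(i | (i != root) && (par i == k)) (pi i / pi k) *: y i].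

Lemma lift_linear n : linear (@lift n).
Proof.
move=> a x y; apply/ffunP => i; rewrite !ffunE; case: ifP => // _.
by rewrite scaler0 addr0.
Qed.

HB.instance Definition _ n :=
  GRing.isLinear.Build R {ffun I -> 'cV[R]_n} {ffun I -> 'cV[R]_n} *:%R
    (@lift n) (@lift_linear n).

Lemma liftT_linear n : linear (@liftT n).
Proof.
move=> a x y; apply/ffunP => i; rewrite !ffunE scaler_sumr -big_split.
by apply: eq_bigr => j _; rewrite !ffunE scalerDr !scalerA mulrC.
Qed.

HB.instance Definition _ n :=
  GRing.isLinear.Build R {ffun I -> 'cV[R]_n} {ffun I -> 'cV[R]_n} *:%R
    (@liftT n) (@liftT_linear n).

Lemma sum_lift (f : I -> I -> R) :
  \sum_(i | i != root) f i (par i)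
  = \sum_k \sum_(i | (i != root) && (par i == k)) f i k.
Proof.
rewrite (partition_big par xpredT) //=; apply: eq_bigr => k _.
by apply: eq_bigr => i /andP[_ /eqP ->].
Qed.

Lemma lift_adj n (x y : {ffun I -> 'cV[R]_n}) : fam_ip (lift x) y = fam_ip x (liftT y).
Proof.
have hv := inner_product_vdot R n.
rewrite /fam_ip (bigID (fun i => i == root)) /= big1 ?add0r; last first.
  by move=> i /eqP ->; rewrite ffunE eqxx (ip0l hv) mulr0.
rewrite (eq_bigr (fun i => pi i * vdot (x (par i)) (y i))); last first.
  by move=> i /negbTE i0; rewrite ffunE i0.
rewrite (sum_lift (fun i k => pi i * vdot (x k) (y i))); apply: eq_bigr => k _.
rewrite ffunE -[vdot (x k) _](ipC hv).
elim/big_rec2: _ => [|i a b _ ->]; first by rewrite (ip0l hv) mulr0.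
rewrite (ipDl hv) (ipZl hv) mulrDr (ipC hv (y i)); congr (_ + _).
by field; rewrite gt_eqF.
Qed.

(** Each value [x k] is copied to all children of [k], and is therefore counted with their total
    weight, which is at most [pi k]. *)
Lemma fam_norm_lift n (x : {ffun I -> 'cV[R]_n}) :
  ipnorm (@fam_ip n) (lift x) <= ipnorm (@fam_ip n) x.
Proof.
have hv := inner_product_vdot R n.
rewrite /ipnorm ler_sqrt ?(ip_ge0 (inner_product_fam n)) //.
rewrite /fam_ip (bigID (fun i => i == root)) /= big1 ?add0r; last first.
  by move=> i /eqP ->; rewrite ffunE eqxx (ip0l hv) mulr0.
rewrite (eq_bigr (fun i => pi i * vdot (x (par i)) (x (par i)))); last first.
  by move=> i /negbTE i0; rewrite ffunE i0.
rewrite (sum_lift (fun i k => pi i * vdot (x k) (x k))); apply: ler_sum => k _.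
by rewrite -mulr_suml ler_wpM2r ?(ip_ge0 hv).
Qed.

Lemma fam_norm_iter_lift n m (x : {ffun I -> 'cV[R]_n}) :
  ipnorm (@fam_ip n) (iter m (@lift n) x) <= ipnorm (@fam_ip n) x.
Proof. by elim: m => //= m IH; rewrite (le_trans (fam_norm_lift _)). Qed.

Lemma iter_lift_eq0 n m (x : {ffun I -> 'cV[R]_n}) i :
  (st i < m)%N -> iter m (@lift n) x i = 0.
Proof.
elim: m i => //= m IH i lim; rewrite ffunE; case: ifPn => // i0.
by apply: IH; rewrite -ltnS -(st_par i0).
Qed.

Section Recursion.
Variables (n : nat) (Phi : I -> 'M[R]_n).

(** The product of [Phi] over the last [m] nodes of the path ending at [i]. It is meaningful for
    [m <= st i] only, since [par] is arbitrary at the root. *)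
Fixpoint transition (m : nat) (i : I) : 'M[R]_n :=
  if m is m'.+1 then Phi i *m transition m' (par i) else 1%:M.

Variables (L alpha : R).
Hypotheses (L_ge1 : 1 <= L) (alpha01 : 0 < alpha < 1).
Hypothesis transition_le : forall m i v, (m <= st i)%N ->
  vnorm (transition m i *m v) <= L * alpha ^+ m * vnorm v.

Definition recstep (x : {ffun I -> 'cV[R]_n}) := mulf Phi (lift x).

Lemma recstep_linear : linear recstep.
Proof. by move=> a x y; rewrite /recstep lift_linear mulf_linear. Qed.

HB.instance Definition _ :=
  GRing.isLinear.Build R {ffun I -> 'cV[R]_n} {ffun I -> 'cV[R]_n} *:%R
    recstep recstep_linear.

Lemma iter_step m h i : iter m recstep h i = transition m i *m iter m (@lift n) h i.
Proof.
elim: m i => [|m IH] i /=; first by rewrite mul1mx.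
by rewrite !ffunE; case: ifP => _; rewrite ?mulmx0 // IH mulmxA.
Qed.

Lemma iter_step_eq0 m h i : (st i < m)%N -> iter m recstep h i = 0.
Proof. by move=> lim; rewrite iter_step iter_lift_eq0 ?mulmx0. Qed.

Lemma fam_norm_iter_step m h :
  ipnorm (@fam_ip n) (iter m recstep h) <= L * alpha ^+ m * ipnorm (@fam_ip n) h.
Proof.
have Lam : 0 <= L * alpha ^+ m.
  have /andP[a0 _] := alpha01.
  by rewrite mulr_ge0 ?exprn_ge0 ?(ltW a0) ?(le_trans ler01) //.
(* Past the root nothing bounds [transition], but there the shifted family vanishes, so the matrix
   may be replaced by zero. *)
pose M i := if (m <= st i)%N then transition m i else 0.
have -> : iter m recstep h = mulf M (iter m (@lift n) h).
  apply/ffunP => i; rewrite ffunE /M; case: leqP => mi; first by rewrite iter_step.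
  by rewrite iter_step_eq0 ?mul0mx.
apply: le_trans (fam_norm_mulf_le _ Lam _) _; last first.
  by rewrite ler_wpM2l ?fam_norm_iter_lift.
move=> i v; rewrite /M; case: leqP => mi; first exact: transition_le.
rewrite mul0mx [vnorm 0](ipnorm0 (inner_product_vdot R n)).
by rewrite mulr_ge0 ?vnorm_ge0.
Qed.

Definition depth := (\max_i st i).+1.

Lemma iter_step_depth h : iter depth recstep h = 0.
Proof.
by apply/ffunP => i; rewrite iter_step_eq0 ?ffunE // ltnS (leq_bigmax i).
Qed.

(** [recstep] is nilpotent of order at most [depth], so its Neumann series is a finite sum. *)
Lemma recursion_solvable h : exists x, x = recstep x + h.
Proof.
exists (\sum_(0 <= m < depth) iter m recstep h).
apply/esym/eqP; rewrite -subr_eq0 raddf_sum addrAC -sumrB.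
by rewrite (telescope_sumr (fun m => iter m recstep h)) // iter_step_depth add0r addNr.
Qed.

(** Iterating the equation [depth] times expresses [x] as the finite Neumann sum of [h]; the bounds
    on its terms form a geometric series. *)
Lemma fam_norm_recursion x h : x = recstep x + h ->
  ipnorm (@fam_ip n) x <= L / (1 - alpha) * ipnorm (@fam_ip n) h.
Proof.
move=> xE; have hE : h = x - recstep x by rewrite {1}xE addrAC subrr add0r.
have iterB m y z : iter m recstep (y - z) = iter m recstep y - iter m recstep z.
  by elim: m => //= m ->; rewrite raddfB.
have -> : x = \sum_(m <- iota 0 depth) iter m recstep h.
  rewrite -[iota _ _]/(index_iota 0 depth).
  rewrite (telescope_sumr_eq (fun m => - iter m recstep x)) => [||m _] //.
    by rewrite iter_step_depth oppr0 opprK add0r.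
  by rewrite hE iterB -iterSr /= opprK addrC.
apply: le_trans (ipnorm_sum (inner_product_fam n) _ _) _.
apply: le_trans (ler_sum _ (fun m _ => fam_norm_iter_step m h)) _.
rewrite -mulr_suml ler_wpM2r ?ipnorm_ge0 // -mulr_sumr ler_wpM2l ?(le_trans ler01) //.
rewrite -[leRHS]mul1r ler_pdivlMr ?subr_gt0; last by case/andP: alpha01.
rewrite -[iota _ _]/(index_iota 0 depth) mulrC big_mkord.
rewrite -[leLHS]opprK -mulNr opprB -subrX1 opprB lerBlDr lerDl exprn_ge0 //.
by case/andP: alpha01 => /ltW.
Qed.

End Recursion.
End Tree.
End Family.

(** * Constants *)

Section Constants.
Variables (R : realType) (L alpha gamma : R).
Hypotheses (L_ge1 : 1 <= L) (alpha01 : 0 < alpha < 1) (gamma01 : 0 < gamma <= 1).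

(** Bound for a right inverse of the dynamics: [L / (1 - alpha)] controls the closed-loop state, and
    [1 + L] accounts for the control obtained from it by feedback. *)
Definition reach : R := (1 + L) * (L / (1 - alpha)).

Lemma inv_alphaC_ge1 : 1 <= (1 - alpha)^-1.
Proof.
have /andP[a0 a1] := alpha01.
by rewrite invf_ge1 ?subr_gt0 //; lra.
Qed.

Lemma reach_ge2 : 2 <= reach.
Proof.
have h1 := inv_alphaC_ge1; have hL := L_ge1.
have h2 : 1 <= L / (1 - alpha) by rewrite -[leLHS]mulr1 ler_pM.
by rewrite /reach; move: (L / _) h2 => e h2; nra.
Qed.

Lemma gamma_FE : gamma_F L alpha = (reach ^+ 2)^-1.
Proof.
have /andP[a0 a1] := alpha01; have hL := L_ge1.
rewrite /gamma_F /reach; field.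
by rewrite !gt_eqF //; lra.
Qed.

Lemma gamma_GE : gamma_G L alpha gamma = gamma / (2 * (L * reach) ^+ 2).
Proof.
have /andP[a0 a1] := alpha01; have hL := L_ge1.
rewrite /gamma_G /reach; field.
by rewrite !gt_eqF //; lra.
Qed.

Lemma gamma_G_gt0 : 0 < gamma_G L alpha gamma.
Proof.
have /andP[g0 _] := gamma01; have hr := reach_ge2; have hL := L_ge1.
by rewrite gamma_GE divr_gt0 // mulr_gt0 // exprn_gt0 // mulr_gt0; lra.
Qed.

(** The left side is the form in which the lower bound for [H] arises. Its factors are dominated one
    by one: [L <= 4 * L_H], [L + 1 <= L_H], and [mu_bar] is nonnegative. *)
Lemma inv_gamma_H_ge :
  2 / gamma_G L alpha gamma + reach ^+ 2 * (L / gamma_G L alpha gamma + 1) * (L + 1)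
  <= (gamma_H L alpha gamma)^-1.
Proof.
have hL := L_ge1; have hr := reach_ge2; have hG := gamma_G_gt0.
rewrite /gamma_H invrK /mu_bar gamma_FE /L_H.
set g := gamma_G _ _ _ in hG *; set a := reach in hr *.
have a2 : 0 < a ^+ 2 by rewrite exprn_gt0 //; lra.
have b0 : 0 < g^-1 by rewrite invr_gt0.
rewrite !invrK -exprVn; set b := g^-1 in b0 *; set a' := a ^+ 2 in a2 *.
set H := 2 * L + 1; have HL1 : 2 * L + 1 = H by [].
have H0 : 0 < H by rewrite /H; lra.
move: H HL1 H0 => H HL1 H0.
have mu0 : 0 <= (2 * H ^+ 2 * b + g + H) * a'.
  have h1 := mulr_gt0 (exprn_gt0 2 H0) b0.
  by apply: mulr_ge0; rewrite ?ltW //; lra.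
set m := _ * a' in mu0 *.
have Hb0 : 0 <= 4 * H ^+ 2 * b ^+ 2.
  by rewrite !mulr_ge0 ?ler0n ?ltW.
have p1 : 1 + L * b <= 1 + 4 * H * b + 4 * H ^+ 2 * b ^+ 2.
  have : 0 <= (4 * H - L) * b by apply: mulr_ge0; rewrite ?(ltW b0) //; lra.
  by lra.
have p2 : a' * (L + 1) <= H * (1 + m * H) * a'.
  have mH : 0 <= m * H by rewrite mulr_ge0 ?(ltW H0).
  have mHH : 0 <= H * (m * H) by rewrite mulr_ge0 ?(ltW H0).
  by rewrite mulrC ler_wpM2r ?(ltW a2) //; lra.
have : (1 + L * b) * (a' * (L + 1))
       <= (1 + 4 * H * b + 4 * H ^+ 2 * b ^+ 2) * (H * (1 + m * H) * a').
  apply: ler_pM => //; first by rewrite addr_ge0 ?mulr_ge0 ?(ltW b0) //; lra.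
  by apply: mulr_ge0; rewrite ?(ltW a2) //; lra.
lra.
Qed.

Lemma gamma_H_gt0 : 0 < gamma_H L alpha gamma.
Proof.
have hL := L_ge1; have hr := reach_ge2; have hG := gamma_G_gt0.
rewrite -invr_gt0; apply: lt_le_trans inv_gamma_H_ge.
have b0 : 0 < (gamma_G L alpha gamma)^-1 by rewrite invr_gt0.
have Lb : 0 < L / gamma_G L alpha gamma by apply: mulr_gt0 => //; lra.
have a2 : 0 < reach ^+ 2 by rewrite exprn_gt0 //; lra.
apply: addr_gt0; first by lra.
by apply: mulr_gt0; first apply: mulr_gt0; lra.
Qed.

Lemma gamma_H_lt1 : gamma_H L alpha gamma < 1.
Proof.
have hL := L_ge1; have hr := reach_ge2; have hG := gamma_G_gt0.
rewrite -invf_gt1 ?gamma_H_gt0 //.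
apply: lt_le_trans inv_gamma_H_ge.
have b0 : 0 < (gamma_G L alpha gamma)^-1 by rewrite invr_gt0.
set b := _^-1 in b0 *.
have : 1 <= reach ^+ 2 by rewrite exprn_ege1 //; lra.
have : 0 < L * b by rewrite mulr_gt0 //; lra.
move: (reach ^+ 2) (L * b) => x y y0 x1.
have z1 : 1 <= x * (y + 1) by nra.
by move: (x * _) z1 => z z1; nra.
Qed.

Lemma L_H_ge3 : 3 <= L_H L.
Proof. by have := L_ge1; rewrite /L_H; lra. Qed.

Lemma rho_sqr : rho L alpha gamma ^+ 2 =
  (L_H L ^+ 2 - gamma_H L alpha gamma ^+ 2) / (L_H L ^+ 2 + gamma_H L alpha gamma ^+ 2).
Proof.
have h1 := gamma_H_gt0; have h2 := gamma_H_lt1; have h3 := L_H_ge3.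
rewrite /rho sqr_sqrtr // divr_ge0 //; last by rewrite addr_ge0 ?sqr_ge0.
by rewrite subr_ge0 lerXn2r ?nnegrE //; lra.
Qed.

Lemma rho_gt0 : 0 < rho L alpha gamma.
Proof.
have h1 := gamma_H_gt0; have h2 := gamma_H_lt1; have h3 := L_H_ge3.
rewrite /rho sqrtr_gt0 divr_gt0 //; last by rewrite addr_gt0 ?exprn_gt0 //; lra.
by rewrite subr_gt0 ltrXn2r ?nnegrE //; lra.
Qed.

Lemma rho_le1 : rho L alpha gamma <= 1.
Proof.
have h3 := L_H_ge3; have h1 := gamma_H_gt0.
rewrite -(ler_pXn2r (n := 2)) ?nnegrE ?(ltW rho_gt0) // rho_sqr expr1n.
rewrite ler_pdivrMr ?mul1r; last by rewrite addr_gt0 ?exprn_gt0 //; lra.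
by have := sqr_ge0 (gamma_H L alpha gamma); lra.
Qed.

(* The [rho^-1] in [c_1] pays for the parity of [D]. *)
Lemma decay_rate_le D :
  (rho L alpha gamma ^+ 2) ^+ D./2 * (gamma_H L alpha gamma)^-1
  <= c_1 L alpha gamma * rho L alpha gamma ^+ D.
Proof.
have g0 := gamma_H_gt0; have g1 := gamma_H_lt1; have h3 := L_H_ge3.
have r0 := rho_gt0; have r1 := rho_le1.
set g := gamma_H _ _ _ in g0 g1 *; set r := rho _ _ _ in r0 r1 *.
have -> : c_1 L alpha gamma * r ^+ D = (r ^+ D / r) * (L_H L / g ^+ 2).
  by rewrite /c_1 -/g -/r; field; rewrite !gt_eqF.
clearbody g r; rewrite -exprM mul2n; apply: ler_pM; rewrite ?exprn_ge0 ?invr_ge0 ?(ltW r0) ?(ltW g0) //.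
  rewrite -{2}(odd_double_half D) exprD.
  case: odd; rewrite ?expr1 ?expr0.
    by rewrite mulrAC mulfV ?mul1r // gt_eqF.
  by rewrite mul1r ler_peMr ?exprn_ge0 ?(ltW r0) // invf_ge1.
rewrite expr2 invfM mulrA ler_peMl ?invr_ge0 ?(ltW g0) //.
rewrite -[1](@mulfV _ g) ?gt_eqF // ler_wpM2r ?invr_ge0 ?(ltW g0) //; lra.
Qed.

End Constants.

(** * Decay of the inverse of a banded self-adjoint operator *)

Section Decay.
Variables (R : realType) (V : lmodType R) (ip : V -> V -> R) (H : {linear V -> V}).
Variables (g l : R) (van : nat -> V -> Prop).
Hypothesis ipV : inner_product ip.
Hypothesis H_sym : forall u v, ip (H u) v = ip u (H v).
Hypotheses (g_gt0 : 0 < g) (g_lt_l : g < l).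
Hypothesis H_ge : forall v, g * ipnorm ip v <= ipnorm ip (H v).
Hypothesis H_le : forall v, ipnorm ip (H v) <= l * ipnorm ip v.
Hypothesis van0 : van 0 0.
Hypothesis van_lin : forall b a u v, van b u -> van b v -> van b (a *: u + v).
Hypothesis van_le : forall b b' u, (b <= b')%N -> van b u -> van b' u.
Hypothesis van_H : forall b u, van b u -> van b.+1 (H u).

Local Notation N := (ipnorm ip).
Local Notation c := (2 / (l ^+ 2 + g ^+ 2)).
Local Notation r := ((l ^+ 2 - g ^+ 2) / (l ^+ 2 + g ^+ 2)).

Let l_gt0 : 0 < l. Proof. exact: lt_trans g_lt_l. Qed.

(** With the form of [H^2] between [g ^+ 2] and [l ^+ 2], the choice of [c] places that of
    [1 - c H^2] symmetrically between [- r] and [r], the smallest such interval. *)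
Definition contraction v := v - c *: H (H v).

Lemma contraction_linear : linear contraction.
Proof.
move=> a u v; rewrite /contraction !(linearP H) scalerDr scalerBr opprD.
by rewrite !scalerA (mulrC a) addrACA.
Qed.

HB.instance Definition _ :=
  GRing.isLinear.Build R V V *:%R contraction contraction_linear.

Lemma norm_contraction v : N (contraction v) <= r * N v.
Proof.
have d0 : 0 < l ^+ 2 + g ^+ 2 by rewrite addr_gt0 ?exprn_gt0.
have gl : g ^+ 2 < l ^+ 2 by rewrite ltrXn2r ?nnegrE ?(ltW g_gt0) ?(ltW l_gt0).
apply: (selfadjoint_norm_le ipV) => [|u {}v|{}v]; first by rewrite divr_gt0 ?subr_gt0.
  rewrite /= /contraction (ipDl ipV) (ipDr ipV) (ipNl ipV) (ipNr ipV).
  by rewrite (ipZl ipV) (ipZr ipV) !H_sym.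
rewrite /= /contraction (ipDr ipV) (ipNr ipV) (ipZr ipV) -H_sym.
rewrite -!(ipnorm_sqr ipV).
have h1 : N (H v) ^+ 2 <= l ^+ 2 * N v ^+ 2.
  by rewrite -exprMn lerXn2r ?nnegrE ?mulr_ge0 ?ipnorm_ge0 ?(ltW l_gt0).
have h2 : g ^+ 2 * N v ^+ 2 <= N (H v) ^+ 2.
  by rewrite -exprMn lerXn2r ?nnegrE ?mulr_ge0 ?ipnorm_ge0 ?(ltW g_gt0).
move: (N (H v) ^+ 2) (N v ^+ 2) h1 h2 => p q h1 h2.
have -> : q - c * p = ((l ^+ 2 + g ^+ 2) * q - 2 * p) / (l ^+ 2 + g ^+ 2).
  by field; rewrite gt_eqF.
rewrite normrM (gtr0_norm (x := _^-1)) ?invr_gt0 // mulrAC ler_pM2r ?invr_gt0 //.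
by rewrite ler_norml; apply/andP; split; lra.
Qed.

(** [van b u] is to be read as: [u] vanishes at distance [b] or more from a fixed stage, so [van 0]
    leaves only zero. The approximation [e] is the Neumann sum of [n] terms for [z], written as [z]
    minus the [n]-th iterate of the contraction. *)
Lemma operator_inverse_decay z p n : H z = p -> van 1 p ->
  exists e, van (2 * n) e /\ N (z - e) <= r ^+ n * (g^-1 * N p).
Proof.
move=> Hz p1; exists (z - iter n contraction z); split.
  elim: n => [|n IH]; first by rewrite subrr.
  (* The equation [H z = p] makes [z] a fixed point of [y |-> c H p + contraction y], and the
     truncations obey the same recursion. The term [H p] is in [van 2], and each contraction widens
     the support by two. *)
  have -> : z - iter n.+1 contraction z
            = c *: H p + contraction (z - iter n contraction z).
    have Mz : c *: H p + contraction z = z by rewrite /contraction Hz addrC subrK.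
    by rewrite [contraction _]raddfB /= addrA Mz.
  rewrite mulnS; set e := _ - _ in IH *.
  apply: van_lin; first by apply: van_le (van_H p1); rewrite leq_addr.
  have -> : contraction e = (- c) *: H (H e) + e by rewrite scaleNr addrC.
  apply: van_lin; first exact: van_H (van_H IH).
  by apply: van_le IH; rewrite leq_addl.
rewrite opprB addrC subrK.
have {p1} z_le : N z <= g^-1 * N p by rewrite mulrC ler_pdivlMr // mulrC -Hz.
have r0 : 0 <= r.
  have gl : g ^+ 2 < l ^+ 2 by rewrite ltrXn2r ?nnegrE ?(ltW g_gt0) ?(ltW l_gt0).
  by rewrite divr_ge0 ?subr_ge0 ?addr_ge0 ?sqr_ge0 ?(ltW gl).
elim: n => [|n IH] /=; first by rewrite expr0 mul1r.
by rewrite exprS -mulrA (le_trans (norm_contraction _)) ?ler_wpM2l.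
Qed.

Lemma bounded_below_inj : injective H.
Proof.
move=> u v Huv; apply/eqP; rewrite -subr_eq0; apply/eqP.
apply: (ipnorm_eq0 ipV); apply/eqP; rewrite eq_le ipnorm_ge0 andbT.
by rewrite -(ler_pM2l g_gt0) mulr0 (le_trans (H_ge _)) // [H _]raddfB /= Huv subrr ipnorm0.
Qed.

End Decay.

(** * Optimality system on a weighted tree *)

Lemma tdist_succl a t b : (b < tdist a.+1 t)%N -> (b <= tdist a t)%N.
Proof. by rewrite /tdist; case: (leqP a t); case: (leqP a.+1 t); lia. Qed.

Lemma tdist_succr a t b : (b < tdist a t)%N -> (b <= tdist a.+1 t)%N.
Proof. by rewrite /tdist; case: (leqP a t); case: (leqP a.+1 t); lia. Qed.

Section KKT.
Variables (R : realType) (I : finType) (pi : I -> R) (root : I) (par : I -> I).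
Variables (st : I -> nat) (nx nu : nat).
Hypothesis pi_gt0 : forall i, 0 < pi i.
Hypothesis st_par : forall i, i != root -> st i = (st (par i)).+1.
Hypothesis pi_children : forall k, \sum_(i | (i != root) && (par i == k)) pi i <= pi k.
Variables (A Q : I -> 'M[R]_nx) (B : I -> 'M[R]_(nx, nu)) (Rm : I -> 'M[R]_nu).
Variables (Qh : I -> 'M[R]_nx) (K : I -> 'M[R]_(nu, nx)) (K' : I -> 'M[R]_nx).
Variables (L alpha gamma : R).
Hypotheses (L_ge1 : 1 <= L) (alpha01 : 0 < alpha < 1) (gamma01 : 0 < gamma <= 1).
Hypothesis A_le : forall i v, vnorm (A i *m v) <= L * vnorm v.
Hypothesis B_le : forall i v, vnorm (B i *m v) <= L * vnorm v.
Hypothesis Q_le : forall i v, vnorm (Q i *m v) <= L * vnorm v.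
Hypothesis R_le : forall i v, vnorm (Rm i *m v) <= L * vnorm v.
Hypothesis K_le : forall i v, vnorm (K i *m v) <= L * vnorm v.
Hypothesis K'_le : forall i v, vnorm (K' i *m v) <= L * vnorm v.
Hypothesis Q_sym : forall i, (Q i)^T = Q i.
Hypothesis R_sym : forall i, (Rm i)^T = Rm i.
Hypothesis R_ge : forall i v, gamma * vnorm2 v <= vdot v (Rm i *m v).
Hypothesis Qh_sym : forall i, (Qh i)^T = Qh i.
Hypothesis Qh_sqr : forall i, Qh i *m Qh i = Q i.
Hypothesis stabilizable : forall m i v, (m <= st i)%N ->
  vnorm (transition par (fun i => A i - B i *m K (par i)) m i *m v)
    <= L * alpha ^+ m * vnorm v.
Hypothesis detectable : forall m i v, (m <= st i)%N ->
  vnorm (transition par (fun i => A i - K' i *m Qh (par i)) m i *m v)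
    <= L * alpha ^+ m * vnorm v.

Let L_ge0 : 0 <= L. Proof. exact: le_trans ler01 L_ge1. Qed.

Local Notation X := {ffun I -> 'cV[R]_nx}.
Local Notation U := {ffun I -> 'cV[R]_nu}.
Local Notation lft := (lift root par).
Local Notation lftT := (liftT pi root par).

Definition ipX : X -> X -> R := @fam_ip R I pi nx.
Definition ipU : U -> U -> R := @fam_ip R I pi nu.
Definition ipW (w w' : X * U) : R := ipX w.1 w'.1 + ipU w.2 w'.2.
Definition ipZ (z z' : X * U * X) : R := ipW z.1 z'.1 + ipX z.2 z'.2.

Lemma inner_product_X : inner_product ipX.
Proof. exact: inner_product_fam. Qed.
Lemma inner_product_U : inner_product ipU.
Proof. exact: inner_product_fam. Qed.
Lemma inner_product_W : inner_product ipW.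
Proof. exact: inner_product_pair inner_product_X inner_product_U. Qed.
Lemma inner_product_Z : inner_product ipZ.
Proof. exact: inner_product_pair inner_product_W inner_product_X. Qed.
Local Notation hX := inner_product_X.
Local Notation hU := inner_product_U.
Local Notation hW := inner_product_W.
Local Notation hZ := inner_product_Z.

Definition costop (w : X * U) : X * U := (mulf Q w.1, mulf Rm w.2).
(** Residual of the dynamics with [d] moved to the right-hand side. At the root only [- w.1]
    remains, so the initial condition is one of the equations. *)
Definition dynop (w : X * U) : X := mulf A (lft w.1) + mulf B (lft w.2) - w.1.
Definition dynopT (y : X) : X * U :=
  (lftT (mulf (fun i => (A i)^T) y) - y, lftT (mulf (fun i => (B i)^T) y)).
Definition kktop (z : X * U * X) : X * U * X := (costop z.1 + dynopT z.2, dynop z.1).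

Lemma pair_linearE (E F : lmodType R) a (p p' : E) (q q' : F) :
  a *: (p, q) + (p', q') = (a *: p + p', a *: q + q').
Proof. by []. Qed.

Lemma costop_linear : linear costop.
Proof. by move=> a w w'; rewrite /costop pair_linearE -!mulf_linear. Qed.

HB.instance Definition _ :=
  GRing.isLinear.Build R (X * U)%type (X * U)%type *:%R costop costop_linear.

Lemma dynop_linear : linear dynop.
Proof.
move=> a w w'.
rewrite /dynop -[fst (_ + _)]/(a *: w.1 + w'.1) -[snd (_ + _)]/(a *: w.2 + w'.2).
rewrite !lift_linear !mulf_linear !scalerDr scalerN opprD.
by rewrite [in RHS]addrACA; congr (_ + _); rewrite addrACA.
Qed.

HB.instance Definition _ :=
  GRing.isLinear.Build R (X * U)%type X *:%R dynop dynop_linear.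

Lemma dynopT_linear : linear dynopT.
Proof.
move=> a y y'; rewrite /dynopT pair_linearE !mulf_linear !liftT_linear.
by congr (_, _); rewrite scalerBr opprD addrACA.
Qed.

HB.instance Definition _ :=
  GRing.isLinear.Build R X (X * U)%type *:%R dynopT dynopT_linear.

Lemma kktop_linear : linear kktop.
Proof.
move=> a z z'; rewrite /kktop pair_linearE.
rewrite -[fst (_ + _)]/(a *: z.1 + z'.1) -[snd (_ + _)]/(a *: z.2 + z'.2).
by rewrite costop_linear dynopT_linear dynop_linear; congr (_, _); rewrite scalerDr [LHS]addrACA.
Qed.

HB.instance Definition _ :=
  GRing.isLinear.Build R (X * U * X)%type (X * U * X)%type *:%R kktop kktop_linear.

Lemma dynop_adj w y : ipX (dynop w) y = ipW w (dynopT y).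
Proof.
rewrite /dynop /ipW /dynopT /= !(ipDl hX) (ipDr hX) (ipNl hX) (ipNr hX).
rewrite /ipX /ipU !mulf_adj !(lift_adj pi_gt0); ring.
Qed.

Lemma costop_sym w w' : ipW (costop w) w' = ipW w (costop w').
Proof.
rewrite /ipW /ipX /ipU !mulf_adj /=; congr (_ + _); congr fam_ip.
  by apply/ffunP => i; rewrite !ffunE Q_sym.
by apply/ffunP => i; rewrite !ffunE R_sym.
Qed.

Lemma kktop_sym z z' : ipZ (kktop z) z' = ipZ z (kktop z').
Proof.
rewrite /ipZ /= (ipDl hW) (ipDr hW) costop_sym dynop_adj (ipC hX z.2) dynop_adj.
by rewrite (ipC hW (dynopT z.2)); ring.
Qed.

(** The term in [Qh] is kept because it is the output from which detectability recovers the
    state. *)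
Lemma costop_ge w :
  ipnorm ipX (mulf Qh w.1) ^+ 2 + gamma * ipnorm ipU w.2 ^+ 2 <= ipW w (costop w).
Proof.
rewrite (ipnorm_sqr hX) (ipnorm_sqr hU); apply: lerD.
  rewrite /ipX mulf_adj; apply: ler_sum => i _.
  by rewrite !ffunE Qh_sym mulmxA Qh_sqr.
rewrite mulr_sumr; apply: ler_sum => i _.
by rewrite ffunE mulrCA ler_pM2l //; exact: R_ge.
Qed.

Lemma costop_ge0 w : 0 <= ipW w (costop w).
Proof.
have /andP[/ltW g0 _] := gamma01.
by apply: le_trans (costop_ge w); rewrite addr_ge0 ?sqr_ge0 // mulr_ge0 ?sqr_ge0.
Qed.

Lemma norm_costop w : ipnorm ipW (costop w) <= L * ipnorm ipW w.
Proof.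
apply: ipnorm_le; first by rewrite mulr_ge0 ?ipnorm_ge0.
rewrite exprMn (ipnorm_sqr hW) /ipW mulrDr -!(ipnorm_sqr hX) -!(ipnorm_sqr hU).
rewrite -!exprMn; apply: lerD; rewrite lerXn2r ?nnegrE ?mulr_ge0 ?ipnorm_ge0 //.
  exact: fam_norm_mulf_le.
exact: fam_norm_mulf_le.
Qed.

Lemma quad_costop_le w : ipW w (costop w) <= L * ipW w w.
Proof.
rewrite -(ipnorm_sqr hW); apply: le_trans (cauchy_schwarz hW _ _) _.
by rewrite mulrC expr2 mulrA ler_wpM2r ?ipnorm_ge0 ?norm_costop.
Qed.

Lemma norm_mulf_lift m n (M : I -> 'M[R]_(m, n)) x :
  (forall i v, vnorm (M i *m v) <= L * vnorm v) ->
  ipnorm (@fam_ip R I pi m) (mulf M (lft x)) <= L * ipnorm (@fam_ip R I pi n) x.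
Proof.
move=> M_le; apply: le_trans (fam_norm_mulf_le pi_gt0 _ L_ge0 M_le) _.
by rewrite ler_wpM2l ?fam_norm_lift.
Qed.

Lemma norm_dynop w :
  ipnorm ipX (dynop w) <= (L + 1) * ipnorm ipX w.1 + L * ipnorm ipU w.2.
Proof.
apply: le_trans (ipnormB hX _ _) _.
apply: le_trans (lerD (ipnormD hX _ _) (lexx _)) _.
have := norm_mulf_lift w.1 A_le; have := norm_mulf_lift w.2 B_le.
rewrite -[fam_ip pi (n := nx)]/ipX -[fam_ip pi (n := nu)]/ipU; lra.
Qed.

Lemma quad_kktop z : ipZ z (kktop z) = ipW z.1 (costop z.1) + 2 * ipX (dynop z.1) z.2.
Proof.
by rewrite /ipZ /= (ipDr hW) -dynop_adj (ipC hX z.2); ring.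
Qed.

(** By self-adjointness only the quadratic form has to be bounded: a cost between [0] and [L |w|^2],
    plus a cross term of the dynamics with the multipliers. *)
Lemma norm_kktop z : ipnorm ipZ (kktop z) <= L_H L * ipnorm ipZ z.
Proof.
have L1 := L_ge1.
apply: (selfadjoint_norm_le hZ); [by rewrite /L_H; lra | exact: kktop_sym |].
move=> {}z; rewrite quad_kktop.
have := costop_ge0 z.1; have := quad_costop_le z.1.
have := cauchy_schwarz_abs hX (dynop z.1) z.2.
have := ler_wpM2r (ipnorm_ge0 ipX z.2) (norm_dynop z.1).
rewrite /ipZ /(ipW z.1 z.1) -!(ipnorm_sqr hX) -!(ipnorm_sqr hU) /L_H.
rewrite !ler_norml.
move: (ipW _ _) (ipX _ _) (ipnorm ipX (dynop _)) => c p n.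
move: (ipnorm _ _) (ipnorm _ _) (ipnorm _ _) => u x y h1 /andP[h2 h3] h4 h5.
(* [2 y ((L + 1) x + L u)] is absorbed by the two squares below; this is where
   the constant [2 L + 1] comes from. *)
have s1 : 0 <= (L + 1) * (x - y) ^+ 2 by rewrite mulr_ge0 ?sqr_ge0 ?addr_ge0.
have s2 : 0 <= L * (u - y) ^+ 2 by rewrite mulr_ge0 ?sqr_ge0.
have s3 : 0 <= L * u ^+ 2 by rewrite mulr_ge0 ?sqr_ge0.
have s4 : 0 <= L * x ^+ 2 by rewrite mulr_ge0 ?sqr_ge0.
have s5 := sqr_ge0 u; have s6 := sqr_ge0 x.
by apply/andP; split; lra.
Qed.

(* Simulates the closed loop under the stabilizing feedback [K]. *)
Lemma dynop_solvable h :
  exists w, dynop w = h /\ ipnorm ipW w <= reach L alpha * ipnorm ipX h.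
Proof.
pose Phi i := A i - B i *m K (par i).
(* The sign of [h] comes from the [- w.1] in [dynop]: the closed loop has to satisfy
   [x = recstep x - h]. *)
have [x xE] := recursion_solvable st_par Phi (- h).
pose u : U := - mulf K x.
have hx : ipnorm ipX x <= L / (1 - alpha) * ipnorm ipX h.
  by rewrite -(ipnormN hX h); exact: (fam_norm_recursion pi_gt0 st_par pi_children L_ge1 alpha01 stabilizable xE).
have hu : ipnorm ipU u <= L * ipnorm ipX x.
  by rewrite /u (ipnormN hU); exact: fam_norm_mulf_le.
exists (x, u); split.
  rewrite -[h]opprK -(addrK (recstep root par Phi x) (- h)) (addrC (- h)) -xE opprB.
  rewrite /dynop /=; congr (_ - _); apply/ffunP => i; rewrite /u !ffunE.
  by case: ifP => _; rewrite ?mulmx0 ?addr0 // /Phi mulmxBl mulmxN mulmxA.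
apply: le_trans (_ : (1 + L) * ipnorm ipX x <= _); last first.
  by rewrite /reach -mulrA ler_wpM2l ?addr_ge0.
apply: ipnorm_le; first by rewrite mulr_ge0 ?addr_ge0 ?ipnorm_ge0.
rewrite /ipW /= -(ipnorm_sqr hX) -(ipnorm_sqr hU).
have := ipnorm_ge0 ipU u; have := ipnorm_ge0 ipX x.
move: (ipnorm ipX x) (ipnorm ipU u) hu => p q hq p0 q0.
have : q ^+ 2 <= (L * p) ^+ 2 by rewrite lerXn2r ?nnegrE // mulr_ge0.
have : 0 <= L * p ^+ 2 by rewrite mulr_ge0 ?sqr_ge0.
lra.
Qed.

(** Duality: a bounded right inverse of an operator bounds its adjoint from below. Testing [y]
    against itself as [dynop w] moves the operator to the other side. *)
Lemma norm_dynopT y : ipnorm ipX y <= reach L alpha * ipnorm ipW (dynopT y).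
Proof.
have [w [wy w_le]] := dynop_solvable y.
have [y0|y0] := eqVneq (ipnorm ipX y) 0.
  rewrite y0 mulr_ge0 ?ipnorm_ge0 // (le_trans _ (reach_ge2 L_ge1 alpha01)) //.
have yp : 0 < ipnorm ipX y by rewrite lt_def y0 ipnorm_ge0.
rewrite -(ler_pM2l yp) -expr2 (ipnorm_sqr hX) -{1}wy dynop_adj.
apply: le_trans (cauchy_schwarz hW _ _) _.
by rewrite mulrA (mulrC (ipnorm ipX y)) ler_wpM2r ?ipnorm_ge0.
Qed.

(* Output injection through [K'] bounds the state by the running cost. *)
Lemma costop_coercive w : dynop w = 0 ->
  gamma_G L alpha gamma * ipnorm ipW w ^+ 2 <= ipW w (costop w).
Proof.
move=> w0; pose x := w.1; pose u := w.2; pose s := mulf Qh x.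
(* Adding and subtracting the injection term turns the dynamics into the observer recursion, driven
   by [s] and [u], both of which the running cost controls. *)
pose k : X := mulf K' (lft s) + mulf B (lft u).
have xE : x = recstep root par (fun i => A i - K' i *m Qh (par i)) x + k.
  rewrite -[LHS]add0r -w0 /dynop -/x -/u subrK.
  apply/ffunP => i; rewrite /k /s !ffunE; case: ifP => _; rewrite ?mulmx0 ?addr0 //.
  by rewrite mulmxBl mulmxA addrA subrK.
have hx : ipnorm ipX x <= L / (1 - alpha) * ipnorm ipX k by exact: (fam_norm_recursion pi_gt0 st_par pi_children L_ge1 alpha01 detectable xE).
have hk : ipnorm ipX k <= L * (ipnorm ipX s + ipnorm ipU u).
  apply: le_trans (ipnormD hX _ _) _; rewrite mulrDr; apply: lerD.
    exact: norm_mulf_lift.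
  exact: norm_mulf_lift.
apply: le_trans (costop_ge w); rewrite -/x -/u -/s.
rewrite (ipnorm_sqr hW) /ipW -(ipnorm_sqr hX) -(ipnorm_sqr hU) -/x -/u.
have b1 := inv_alphaC_ge1 alpha01; have L1 := L_ge1; have /andP[g0 g1] := gamma01.
set e := L / (1 - alpha) in hx.
have e1 : 1 <= e by rewrite -[leLHS]mulr1 ler_pM.
have {hx hk} : ipnorm ipX x <= e * (L * (ipnorm ipX s + ipnorm ipU u)).
  by apply: le_trans hx _; rewrite ler_wpM2l // (le_trans ler01).
rewrite gamma_GE // /reach -/e.
move: (ipnorm_ge0 ipX x) (ipnorm_ge0 ipX s) (ipnorm_ge0 ipU u).
move: (ipnorm ipX x) (ipnorm ipX s) (ipnorm ipU u) => p q r p0 q0 r0 hp.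
set C := L * e; have C1 : 1 <= C by rewrite -[leLHS]mulr1 ler_pM.
have {hp} hp : p ^+ 2 <= C ^+ 2 * (2 * (q ^+ 2 + r ^+ 2)).
  apply: le_trans (_ : (C * (q + r)) ^+ 2 <= _).
    have CC : 0 <= C * (q + r) by rewrite mulr_ge0 ?addr_ge0 ?(le_trans ler01 C1).
    by rewrite lerXn2r ?nnegrE // /C -mulrA mulrCA.
  by rewrite exprMn ler_wpM2l ?sqr_ge0 //; have := sqr_ge0 (q - r); lra.
have -> : L * ((1 + L) * e) = (1 + L) * C by rewrite /C; ring.
have C2 : 1 <= C ^+ 2 by rewrite exprn_ege1.
rewrite exprMn; clearbody C.
move: (C ^+ 2) C2 hp => D D1 hp.
(* The factor [(1 + L)^2 >= 4] of [gamma_G] absorbs the coefficients [2 D] and [3 D] below, the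
   latter containing the control part of [|w|^2]. *)
have F4 : 4 <= (1 + L) ^+ 2 by nra.
move: ((1 + L) ^+ 2) F4 => F F4.
have FD : 0 < F * D by apply: mulr_gt0; lra.
rewrite mulrAC ler_pdivrMr; last by apply: mulr_gt0.
have r2 := sqr_ge0 r; have q2 := sqr_ge0 q.
move: (p ^+ 2) (q ^+ 2) (r ^+ 2) hp r2 q2 => P Q2 R2 hp r2 q2.
have FDge : 4 * D <= F * D by apply: ler_wpM2r; lra.
have gq : 0 <= gamma * Q2 by apply: mulr_ge0; lra.
have gr : 0 <= gamma * R2 by apply: mulr_ge0; lra.
have h1 : gamma * (P + R2) <= gamma * (2 * D * Q2 + 3 * D * R2).
  by apply: ler_wpM2l; [lra | nra].
have h2 : (Q2 + gamma * R2) * (2 * (4 * D)) <= (Q2 + gamma * R2) * (2 * (F * D)).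
  by apply: ler_wpM2l; lra.
apply: le_trans h1 (le_trans _ h2).
have h3 : gamma * Q2 * D <= Q2 * D by apply: ler_wpM2r; [lra | nra].
have h4 : 0 <= gamma * R2 * D by apply: mulr_ge0; lra.
have h5 : 0 <= Q2 * D by apply: mulr_ge0; lra.
lra.
Qed.

(* [w] is split into a particular solution of [dynop w0 = dynop w], bounded by
   stabilizability, and an element of the kernel of [dynop], bounded by
   coercivity. *)
Lemma norm_kktop_ge z :
  gamma_H L alpha gamma * ipnorm ipZ z <= ipnorm ipZ (kktop z).
Proof.
have L1 := L_ge1.
case: z => w y; set z := (w, y); set n := ipnorm ipZ (kktop z).
set a := reach L alpha; have a2 : 2 <= a := reach_ge2 L_ge1 alpha01.
have a0 : 0 <= a := le_trans (ler0n R 2) a2.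
set g := gamma_G L alpha gamma.
have g0 : 0 < g := gamma_G_gt0 L_ge1 alpha01 gamma01.
have ZE v : ipnorm ipZ v ^+ 2 = ipnorm ipW v.1 ^+ 2 + ipnorm ipX v.2 ^+ 2.
  by rewrite (ipnorm_sqr hZ) (ipnorm_sqr hW) (ipnorm_sqr hX).
have n0 : 0 <= n by exact: ipnorm_ge0.
have nG : ipnorm ipW (costop w + dynopT y) <= n.
  rewrite -(ler_pXn2r (n := 2)) ?nnegrE ?ipnorm_ge0 // ZE.
  by rewrite lerDl sqr_ge0.
have nh : ipnorm ipX (dynop w) <= n.
  rewrite -(ler_pXn2r (n := 2)) ?nnegrE ?ipnorm_ge0 // ZE.
  by rewrite lerDr sqr_ge0.
have [w0 [w0E w0_le]] := dynop_solvable (dynop w).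
have {}w0_le : ipnorm ipW w0 <= a * n.
  by apply: le_trans w0_le _; rewrite ler_wpM2l.
pose v := w - w0.
have v0 : dynop v = 0 by rewrite /v raddfB /= w0E subrr.
have hv : g * ipnorm ipW v <= n + L * (a * n).
  have [Nv0|Nv0] := eqVneq (ipnorm ipW v) 0.
    by rewrite Nv0 mulr0 addr_ge0 // mulr_ge0 // mulr_ge0.
  have Nvp : 0 < ipnorm ipW v by rewrite lt_def Nv0 ipnorm_ge0.
  rewrite -(ler_pM2r Nvp) -mulrA -expr2.
  apply: le_trans (costop_coercive v0) _.
  (* As [v] is in the kernel of [dynop], it is orthogonal to [dynopT y]; the unknown multiplier can
     be inserted, completing the first component of [kktop z]. *)
  have -> : ipW v (costop v) = ipW v ((costop w + dynopT y) - costop w0).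
    rewrite [costop v]raddfB /= !(ipDr hW) -dynop_adj v0 (ip0l hX) addr0 //.
  apply: le_trans (cauchy_schwarz hW _ _) _.
  rewrite mulrC ler_wpM2r ?ipnorm_ge0 //.
  apply: le_trans (ipnormB hW _ _) _; apply: lerD => //.
  by apply: le_trans (norm_costop _) _; rewrite ler_wpM2l.
have hw : ipnorm ipW w <= (n + L * (a * n)) / g + a * n.
  have -> : w = v + w0 by rewrite subrK.
  apply: le_trans (ipnormD hW _ _) _; apply: lerD => //.
  by rewrite ler_pdivlMr // mulrC.
have hy : ipnorm ipX y <= a * (n + L * ipnorm ipW w).
  apply: le_trans (norm_dynopT y) _; rewrite -/a ler_wpM2l //.
  have -> : dynopT y = (costop w + dynopT y) - costop w by rewrite addrAC subrr add0r.
  by apply: le_trans (ipnormB hW _ _) _; apply: lerD => //; exact: norm_costop.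
have hz : ipnorm ipZ z <= ipnorm ipW w + ipnorm ipX y.
  rewrite -(ler_pXn2r (n := 2)) ?nnegrE ?addr_ge0 ?ipnorm_ge0 // ZE /=.
  have := mulr_ge0 (ipnorm_ge0 ipW w) (ipnorm_ge0 ipX y); lra.
have gH := gamma_H_gt0 L_ge1 alpha01 gamma01.
rewrite mulrC -ler_pdivlMr //; apply: le_trans hz _.
apply: le_trans (_ : n * (2 / g + a ^+ 2 * (L / g + 1) * (L + 1)) <= _); last first.
  by rewrite ler_wpM2l ?inv_gamma_H_ge.
have b0 : 0 < g^-1 by rewrite invr_gt0.
move: (g^-1) b0 hw => b b0 hw; clearbody a n.
have aL : 0 <= a * L by apply: mulr_ge0; lra.
have {}hy : ipnorm ipX y <= a * n + a * L * ((n + L * (a * n)) * b + a * n).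
  apply: le_trans hy _; rewrite mulrDr lerD2l mulrA.
  exact: ler_wpM2l.
(* The bounds on [w] and [y] add up to the target except for terms [2 a] where it has [a ^+ 2];
   [a >= 2] closes this gap. *)
have t1 : 0 <= n * ((a - 2) * a * L * b) by rewrite !mulr_ge0 //; lra.
have t2 : 0 <= n * ((a - 2) * a) by rewrite !mulr_ge0 //; lra.
have t3 : 0 <= n * b by apply: mulr_ge0; lra.
lra.
Qed.

(** The inequality is not strict: [b = 0] forces [z = 0], and [b = 1] means that [z] lives on stage
    [t']. *)
Definition supported_within t' b (z : X * U * X) := forall i, (b <= tdist (st i) t')%N ->
  [/\ z.1.1 i = 0, z.1.2 i = 0 & z.2 i = 0].

Lemma supported_within_kktop t' b z :
  supported_within t' b z -> supported_within t' b.+1 (kktop z).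
Proof.
move=> zb i ib; have [xi ui yi] := zb i (ltnW ib).
have par0 (i0 : i != root) :
    [/\ z.1.1 (par i) = 0, z.1.2 (par i) = 0 & z.2 (par i) = 0].
  by apply: zb; move: ib; rewrite (st_par i0); apply: tdist_succl.
have child0 j : j != root -> par j = i -> z.2 j = 0.
  move=> j0 ji; have [] // := zb j.
  by rewrite (st_par j0) ji; apply: tdist_succr.
split; rewrite /= /dynop !ffunE.
- rewrite xi yi mulmx0 add0r subr0; apply: big1 => j /andP[j0 /eqP ji].
  by rewrite ffunE child0 ?mulmx0 ?scaler0.
- rewrite ui mulmx0 add0r; apply: big1 => j /andP[j0 /eqP ji].
  by rewrite ffunE child0 ?mulmx0 ?scaler0.
rewrite xi subr0; case: ifPn => i0; first by rewrite !mulmx0 addr0.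
by have [-> -> _] := par0 i0; rewrite !mulmx0 addr0.
Qed.

Lemma kktop_inj : injective kktop.
Proof.
apply: (bounded_below_inj hZ (gamma_H_gt0 L_ge1 alpha01 gamma01)).
exact: norm_kktop_ge.
Qed.

Lemma kktop_decay t t' z p : kktop z = p ->
  (forall i, st i != t' -> [/\ p.1.1 i = 0, p.1.2 i = 0 & p.2 i = 0]) ->
  \sum_(i | st i == t)
     pi i * (vnorm2 (z.1.1 i) + vnorm2 (z.1.2 i) + vnorm2 (z.2 i))
  <= (c_1 L alpha gamma * rho L alpha gamma ^+ tdist t t' * ipnorm ipZ p) ^+ 2.
Proof.
move=> zp p0; set D := tdist t t'.
have g0 := gamma_H_gt0 L_ge1 alpha01 gamma01.
have g1 := gamma_H_lt1 L_ge1 alpha01 gamma01.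
have lH := L_H_ge3 L_ge1.
have gl : gamma_H L alpha gamma < L_H L by apply: lt_le_trans g1 _; lra.
have p1 : supported_within t' 1 p.
  move=> i it; apply: p0; apply: contraTN it => /eqP ->.
  by rewrite /tdist leqnn subnn.
have [||||e [eD e_le]] := operator_inverse_decay hZ kktop_sym g0 gl norm_kktop_ge
  norm_kktop (van := supported_within t') _ _ _ _ D./2 zp p1.
- by move=> i _; rewrite /= !ffunE.
- move=> b a u v ub vb i ib; have [u1 u2 u3] := ub i ib; have [v1 v2 v3] := vb i ib.
  by rewrite /= !ffunE u1 u2 u3 v1 v2 v3 !scaler0 !addr0.
- by move=> b b' u bb' ub i ib; apply: ub; apply: leq_trans ib.
- exact: supported_within_kktop.
rewrite -(rho_sqr L_ge1 alpha01 gamma01) mulrA in e_le.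
have {}e_le := le_trans e_le (ler_wpM2r (ipnorm_ge0 ipZ p)
  (decay_rate_le L_ge1 alpha01 gamma01 D)).
set C := _ * ipnorm ipZ p in e_le *.
have C0 : 0 <= C := le_trans (ipnorm_ge0 _ _) e_le.
apply: le_trans (_ : ipnorm ipZ (z - e) ^+ 2 <= _); last first.
  by rewrite lerXn2r ?nnegrE ?ipnorm_ge0.
(* Since [2 * D./2 <= D], the approximation [e] vanishes on stage [t], where [z] therefore equals
   [z - e]; the other stages only add nonnegative terms. *)
rewrite (ipnorm_sqr hZ) /ipZ /ipW /ipX /ipU /fam_ip -!big_split /=.
rewrite [leRHS](bigID (fun i => st i == t)) /= -[leLHS]addr0 lerD //.
  rewrite le_eqVlt; apply/orP; left; apply/eqP; apply: eq_bigr => i /eqP it.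
  have [|e1 e2 e3] := eD i; first by rewrite it mul2n -/D -{2}(odd_double_half D) leq_addl.
  by rewrite !ffunE e1 e2 e3 !subr0 -!mulrDr.
by apply: sumr_ge0 => i _; rewrite !addr_ge0 // mulr_ge0 ?vnorm2_ge0 // ltW.
Qed.

(** The function whose gradient in the weighted product is [kktop z - b]; the Lagrangian of the
    extensive problem takes this form. *)
Definition quadratic_lagrangian (b z : X * U * X) : R :=
  2^-1 * ipZ z (kktop z) - ipZ z b.

Lemma quadratic_lagrangianD b z e : quadratic_lagrangian b (z + e)
  = quadratic_lagrangian b z + ipZ e (kktop z - b)
    + 2^-1 * (ipW e.1 (costop e.1) + 2 * ipX (dynop e.1) e.2).
Proof.
rewrite -quad_kktop /quadratic_lagrangian [kktop (z + e)]raddfD /=.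
rewrite !(ipDl hZ) !(ipDr hZ) (ipNr hZ) -(kktop_sym z e) (ipC hZ (kktop z)).
by field.
Qed.

(** The second-order part of the expansion is convex in the primal direction and vanishes in the
    dual one. Stationarity is thus sufficient; for necessity a nonzero residual is used as direction
    of improvement. *)
Lemma saddle_point_kkt b z :
  (forall y, quadratic_lagrangian b (z.1, y) <= quadratic_lagrangian b z)
  /\ (forall w, quadratic_lagrangian b z <= quadratic_lagrangian b (w, z.2))
  <-> kktop z = b.
Proof.
have z2E y : (z.1, y) = z + (0, y - z.2).
  by case: z => w y'; rewrite -[_ + _]/(w + 0, y' + (y - y')) addr0 subrKC.
have z1E w : (w, z.2) = z + (w - z.1, 0).
  by case: z {z2E} => w' y'; rewrite -[_ + _]/(w' + (w - w'), y' + 0) addr0 subrKC.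
have cost0 : ipW 0 (costop 0) = 0 by rewrite (ip0l hW).
have dyn0 : dynop 0 = 0 by rewrite [dynop 0]raddf0.
split=> [[hy hw]|zb]; last first.
  split=> [y|w]; rewrite (z2E, z1E) quadratic_lagrangianD zb subrr (ip0r hZ) addr0.
    by rewrite /= cost0 dyn0 (ip0l hX) mulr0 addr0 mulr0 addr0.
  by rewrite /= (ip0r hX) mulr0 addr0 lerDl mulr_ge0 ?invr_ge0 ?costop_ge0.
apply/eqP; rewrite -subr_eq0; apply/eqP.
set r := kktop z - b; have rE : r = (r.1, r.2) by case: r.
have r2 : r.2 = 0.
  have := hy (z.2 + r.2); rewrite z2E quadratic_lagrangianD -/r /= cost0 dyn0.
  rewrite (ip0l hX) mulr0 addr0 mulr0 addr0 -[leRHS]addr0 lerD2l.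
  rewrite /ipZ /= (ip0l hW) add0r addrAC subrr add0r => h.
  apply: (ip_def hX); apply/eqP; rewrite eq_le h.
  exact: (ip_ge0 hX).
have r1 : r.1 = 0.
  have L0 : 0 < L := lt_le_trans ltr01 L_ge1.
  (* A gradient step of length [1 / L]: the curvature is at most [L], so the value would drop by at
     least [|r.1|^2 / (2 L)]. *)
  set v := - (L^-1 *: r.1).
  have := hw (z.1 + v); rewrite z1E quadratic_lagrangianD -/r /= (ip0r hX).
  rewrite mulr0 addr0 -addrA -[leLHS]addr0 lerD2l.
  have -> : z.1 + v - z.1 = v by rewrite addrAC subrr add0r.
  rewrite /ipZ /= (ip0l hX) addr0 => h.
  have vv : ipW v v = L^-1 * (L^-1 * ipW r.1 r.1).
    by rewrite /v (ipNl hW) (ipNr hW) opprK (ipZl hW) (ipZr hW).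
  have := quad_costop_le v; rewrite vv mulVKf ?gt_eqF // => h'.
  have vr : ipW v r.1 = - (L^-1 * ipW r.1 r.1) by rewrite /v (ipNl hW) (ipZl hW).
  rewrite vr in h.
  apply: (ip_def hW); apply/eqP; rewrite eq_le (ip_ge0 hW) andbT.
  have Li : 0 < L^-1 by rewrite invr_gt0.
  rewrite -(ler_pM2l Li) mulr0; lra.
by rewrite rE r1 r2.
Qed.

(* The constraints read [dynop w = - d], hence the sign of the last component. *)
Definition source (v : I -> 'cV[R]_(nx + nu + nx)) : X * U * X :=
  ([ffun i => usubmx (usubmx (v i))], [ffun i => dsubmx (usubmx (v i))],
   [ffun i => - dsubmx (v i)]).

Definition block (i : I) (z : X * U * X) : 'cV[R]_(nx + nu + nx) :=
  col_mx (col_mx (z.1.1 i) (z.1.2 i)) (z.2 i).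

Lemma block_linear i : linear (block i).
Proof. by move=> a z z'; rewrite /block /= !ffunE !scale_col_mx !add_col_mx. Qed.

HB.instance Definition _ i :=
  GRing.isLinear.Build R (X * U * X)%type 'cV[R]_(nx + nu + nx) *:%R
    (block i) (block_linear i).

Lemma block_inj z z' : (forall i, block i z = block i z') -> z = z'.
Proof.
case: z z' => [[x u] y] [[x' u'] y'] h.
have {}h i : [/\ x i = x' i, u i = u' i & y i = y' i].
  by have /eq_col_mx[/eq_col_mx[]] := h i.
by congr (_, _, _); apply/ffunP => i; have [] := h i.
Qed.

Lemma block_source i v : block i (source v)
  = col_mx (usubmx (v i)) (- dsubmx (v i)).
Proof. by rewrite /block /= !ffunE vsubmxK. Qed.

Lemma ipZ_source v : ipZ (source v) (source v) = \sum_i pi i * vnorm2 (v i).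
Proof.
rewrite /ipZ /ipW /ipX /ipU /fam_ip -!big_split; apply: eq_bigr => i _ /=.
rewrite -!mulrDr !ffunE (ipNl (inner_product_vdot R nx)) (ipNr (inner_product_vdot R nx)).
by rewrite opprK -[v i in RHS]vsubmxK -[usubmx (v i) in RHS]vsubmxK !vnorm2_col_mx.
Qed.

(** [Om i j] is the response at [i] to data at the single node [j]; the sign that [source] puts on
    [d] is absorbed in it. Superposition gives the representation, and data confined to stage [t']
    give the block estimate. *)
Lemma kktop_green : exists Om : I -> I -> 'M[R]_(nx + nu + nx),
  (forall v, exists2 z, kktop z = source v & forall i, block i z = \sum_j Om i j *m v j) /\
  forall t t' v,
    \sum_(i | st i == t) pi i * vnorm2 (\sum_(j | st j == t') Om i j *m v j)
    <= (c_1 L alpha gamma * rho L alpha gamma ^+ tdist t t') ^+ 2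
       * \sum_(j | st j == t') pi j * vnorm2 (v j).
Proof.
have [g gK] := injective_linear_inverse kktop_inj.
pose single j p := source (fun i => if i == j then p else 0).
have block_single i j p : block i (single j p)
    = if i == j then col_mx (usubmx p) (- dsubmx p) else 0.
  by rewrite block_source; case: eqP => // _; rewrite !linear0 ?oppr0 col_mx0.
have single_linear j : linear (single j).
  move=> a p p'; apply: block_inj => i; rewrite block_linear !block_single.
  case: eqP => _; last by rewrite scaler0 addr0.
  by rewrite !linearP scale_col_mx add_col_mx.
have sourceE v : source v = \sum_j single j (v j).
  apply: block_inj => i; rewrite linear_sum (bigD1 i) //= block_single eqxx.
  rewrite block_source big1 ?addr0 // => j ji.
  by rewrite block_single eq_sym (negbTE ji).
pose f i j p := block i (g (single j p)).
have f_linear i j : linear (f i j).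
  by move=> a p p'; rewrite /f single_linear linearP block_linear.
exists (fun i j => \matrix_(a, b) f i j (delta_mx b 0) a 0).
have green v i : block i (g (source v))
    = \sum_j (\matrix_(a, b) f i j (delta_mx b 0) a 0) *m v j.
  rewrite sourceE !linear_sum; apply: eq_bigr => j _.
  by rewrite (linear_mulmx (f_linear i j)).
split=> [v|t t' v]; first by exists (g (source v)).
pose v' j := if st j == t' then v j else 0.
have := kktop_decay t (gK (source v')) (t' := t') _.
rewrite exprMn (ipnorm_sqr hZ) ipZ_source => h.
rewrite [X in _ * X]big_mkcond /=.
rewrite [X in _ <= _ * X](eq_bigr (fun j => pi j * vnorm2 (v' j))); last first.
  move=> j _; rewrite /v'; case: eqP => // _.
  by rewrite [vnorm2 0](ip0l (inner_product_vdot R _)) mulr0.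
apply: le_trans (h _) => [|i it]; last first.
  by rewrite /= !ffunE /v' (negbTE it) !linear0 ?oppr0.
rewrite le_eqVlt; apply/orP; left; apply/eqP; apply: eq_bigr => i _.
rewrite -!vnorm2_col_mx -/(block i _) green big_mkcond.
congr (_ * vnorm2 _); apply: eq_bigr => j _; rewrite /v'.
by case: eqP => // _; rewrite mulmx0.
Qed.

End KKT.

(** * Canonical scenario tree *)

Section ScenarioTree.
Variables (R : realType) (Xi : choiceType) (T : nat).
Variables (S : seq (seq Xi)) (mu : seq Xi -> R) (xb0 : Xi).
Hypotheses (S_uniq : uniq S) (S_size : forall s, s \in S -> size s = T.+1).
Hypothesis mu_gt0 : forall s, s \in S -> 0 < mu s.
Hypothesis P0_gt0 : 0 < P0 S mu xb0.

Local Notation V := (nodes T S xb0).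
Local Notation node := (seq_sub V).

Lemma nodesP i : reflect
  (exists s t, [/\ s \in S, head xb0 s = xb0, (t <= T)%N & i = take t.+1 s]) (i \in V).
Proof.
rewrite mem_undup; apply: (iffP allpairsPdep) => [[s [t]]|[s [t [sS s0 tT ->]]]].
  by rewrite mem_filter mem_iota ltnS => -[/andP[/eqP s0 sS] tT ->]; exists s, t.
by exists s, t; rewrite mem_filter mem_iota s0 eqxx.
Qed.

Lemma S_nonempty_cond : exists2 s, s \in S & head xb0 s = xb0.
Proof.
have /hasP[s sS /eqP s0] : has (fun s => head xb0 s == xb0) S; last by exists s.
apply: contraTT P0_gt0 => /hasPn h; rewrite /P0 big_seq_cond big_pred0 ?ltxx // => s.
by apply/negP => /andP[/h/negbTE ->].
Qed.

Lemma take1_head s : s \in S -> head xb0 s = xb0 -> take 1 s = Defs.root xb0.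
Proof. by move=> /S_size; case: s => //= a s _ ->; rewrite take0. Qed.

Lemma root_in_nodes : Defs.root xb0 \in V.
Proof.
have [s sS s0] := S_nonempty_cond.
by apply/nodesP; exists s, 0; rewrite take1_head.
Qed.

Definition root_node : node := SeqSub root_in_nodes.
(** The parent sequence of the root is empty and is no node; the default value makes the root its
    own parent. *)
Definition par_node (i : node) : node := insubd root_node (parent (val i)).
Definition stage (i : node) : nat := (size (val i)).-1.
Definition weight (i : node) : R := piN S mu xb0 (val i).
(** Every node has this form, which reduces questions about nodes to prefixes of one support path,
    where the assumptions are stated. *)
Definition path_node (s : seq Xi) (t : nat) : node := insubd root_node (take t.+1 s).

Lemma val_path_node s t : s \in S -> head xb0 s = xb0 -> (t <= T)%N ->
  val (path_node s t) = take t.+1 s.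
Proof. by move=> sS s0 tT; rewrite val_insubd; case: nodesP => // -[]; exists s, t. Qed.

Lemma stage_path_node s t : s \in S -> head xb0 s = xb0 -> (t <= T)%N ->
  stage (path_node s t) = t.
Proof.
by move=> sS s0 tT; rewrite /stage val_path_node // size_takel // S_size.
Qed.

Lemma path_nodeP i : exists s t,
  [/\ s \in S, head xb0 s = xb0, (t <= T)%N & i = path_node s t].
Proof.
have /nodesP[s [t [sS s0 tT iE]]] := valP i.
by exists s, t; split=> //; apply: val_inj; rewrite val_path_node.
Qed.

Lemma path_node0 s : s \in S -> head xb0 s = xb0 -> path_node s 0 = root_node.
Proof. by move=> sS s0; apply: val_inj; rewrite val_path_node // take1_head. Qed.

Lemma path_node_eq_root s t : s \in S -> head xb0 s = xb0 -> (t <= T)%N ->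
  (path_node s t == root_node) = (t == 0).
Proof.
move=> sS s0 tT; apply/eqP/eqP => [h|->]; last exact: path_node0.
by rewrite -(stage_path_node sS s0 tT) h.
Qed.

Lemma par_path_node s t : s \in S -> head xb0 s = xb0 -> (t < T)%N ->
  par_node (path_node s t.+1) = path_node s t.
Proof.
move=> sS s0 tT; apply: val_inj; rewrite /par_node val_path_node //.
by rewrite /parent size_takel ?S_size //= take_takel.
Qed.

Lemma realization_path_node s t : s \in S -> head xb0 s = xb0 -> (t <= T)%N ->
  realization xb0 (val (path_node s t)) = nth xb0 s t.
Proof.
move=> sS s0 tT; rewrite val_path_node // /realization -nth_last.
by rewrite size_takel ?S_size //= nth_take.
Qed.

Lemma stage_par_node i : i != root_node -> stage i = (stage (par_node i)).+1.
Proof.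
have [s [[|t] [sS s0 tT ->]]] := path_nodeP i; first by rewrite path_node0 ?eqxx.
by rewrite par_path_node // !stage_path_node // ltnW.
Qed.

Lemma parent_node i : i != root_node -> val (par_node i) = parent (val i).
Proof.
have [s [[|t] [sS s0 tT ->]]] := path_nodeP i; first by rewrite path_node0 ?eqxx.
move=> _; rewrite par_path_node // !val_path_node ?(ltnW tT) //.
by rewrite /parent size_takel ?S_size //= take_takel.
Qed.

Lemma node_size_gt0 (i : node) : (0 < size (val i))%N.
Proof.
have [s [t [sS s0 tT ->]]] := path_nodeP i.
by rewrite val_path_node // size_takel ?S_size.
Qed.

Lemma weight_gt0 i : 0 < weight i.
Proof.
have [s [t [sS s0 tT ->]]] := path_nodeP i.
rewrite /weight /piN divr_gt0 // big_mkcond (bigD1_seq s) //=.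
rewrite val_path_node // size_takel ?S_size // eqxx ltr_wpDr ?mu_gt0 //.
rewrite big_seq_cond sumr_ge0 // => s' /andP[s'S _].
by case: ifP => // _; rewrite ltW ?mu_gt0.
Qed.

Lemma weight_root : weight root_node = 1.
Proof.
rewrite /weight /piN -[RHS](@divff _ (P0 S mu xb0)) ?gt_eqF //; congr (_ / _).
rewrite /P0 big_seq_cond [RHS]big_seq_cond; apply: eq_bigl => s.
case sS: (s \in S) => //=; have := S_size sS; case: s {sS} => //= a s _.
by rewrite take0 eqseq_cons andbT.
Qed.

(** After exchanging the sums, each path passes through at most one child of [k], and if it does, it
    also passes through [k]. At the last stage there are no children, hence the inequality. *)
Lemma sum_children_weight k :
  \sum_(i | (i != root_node) && (par_node i == k)) weight i <= weight k.
Proof.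
rewrite /weight /piN -mulr_suml ler_wpM2r ?invr_ge0 ?(ltW P0_gt0) //.
rewrite (eq_bigr (fun i : node =>
  \sum_(s <- S) if take (size (val i)) s == val i then mu s else 0)); last first.
  by move=> i _; rewrite big_mkcond.
rewrite exchange_big /= [leRHS]big_mkcond /=.
rewrite big_seq [leRHS]big_seq; apply: ler_sum => s sS; rewrite -big_mkcondr /=.
have [i0 /andP[/andP[i0r /eqP i0k] /eqP i0s]|none] := pickP (fun i : node =>
  (i != root_node) && (par_node i == k) && (take (size (val i)) s == val i)); last first.
  by rewrite big_pred0 //; case: ifP => // _; rewrite ltW ?mu_gt0.
have sizeE (i : node) : i != root_node -> par_node i = k -> size (val i) = (size (val k)).+1.
  move=> ir <-; have := stage_par_node ir; rewrite /stage => h.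
  by rewrite -(prednK (node_size_gt0 i)) h (prednK (node_size_gt0 _)).
rewrite (big_pred1 i0) => [|i /=].
  have kE : val k = take (size (val i0)).-1 s.
    by rewrite -i0k parent_node // /parent -{2}i0s take_takel ?leq_pred.
  have <- : (size (val i0)).-1 = size (val k) by rewrite (sizeE i0).
  by rewrite -kE eqxx.
apply/idP/eqP => [/andP[/andP[ir /eqP ik] /eqP i_s]|->]; last by rewrite i0r i0k i0s !eqxx.
apply: val_inj; rewrite -[LHS]i_s -[RHS]i0s; congr take.
by rewrite [LHS](sizeE i) ?(sizeE i0).
Qed.

Lemma sum_nodes (M : nmodType) (P : pred (seq Xi)) (F : seq Xi -> M) :
  \sum_(i <- V | P i) F i = \sum_(i : node | P (val i)) F (val i).
Proof.
have uV : uniq V by apply: undup_uniq.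
rewrite -[in LHS](val_seq_sub_enum uV) big_map.
apply: perm_big; apply: uniq_perm; rewrite ?index_enum_uniq //.
  by rewrite -(map_inj_uniq val_inj) val_seq_sub_enum.
by move=> i; rewrite mem_seq_sub_enum mem_index_enum.
Qed.

(** Identifies products along the tree with the scenario products of the stability assumptions;
    [m <= t] keeps the walk from passing the root. *)
Lemma transition_path_node n (Phi : node -> 'M[R]_n) (Phis : nat -> 'M[R]_n) s :
  s \in S -> head xb0 s = xb0 ->
  (forall t, (0 < t <= T)%N -> Phi (path_node s t) = Phis t) ->
  forall m t, (m <= t <= T)%N ->
    transition par_node Phi m (path_node s t) = prodPhi Phis (t - m) t.
Proof.
move=> sS s0 PhiE; elim=> [|m IH] [|t] // /andP[mt tT]; rewrite /prodPhi.
- by rewrite subnn /index_iota subnn big_nil.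
- by rewrite subn0 /index_iota subnn big_nil.
have mtT : (m <= t <= T)%N by rewrite -ltnS mt ltnW.
rewrite /= PhiE // par_path_node // (IH _ mtT) ?subSS /prodPhi.
rewrite [index_iota _ t.+2](_ : _ =
  rcons (index_iota (t - m).+1 t.+1) t.+1); first by rewrite rev_rcons big_cons.
rewrite /index_iota (_ : t.+2 - (t - m).+1 = (t.+1 - (t - m).+1) + 1)%N; last by lia.
by rewrite iotaD cats1; congr rcons; lia.
Qed.

Lemma transition_norm_le n (Phi : node -> 'M[R]_n) (Phis : seq Xi -> nat -> 'M[R]_n)
    (L alpha : R) : 1 <= L ->
  (forall s t, s \in S -> head xb0 s = xb0 -> (0 < t <= T)%N ->
     Phi (path_node s t) = Phis s t) ->
  (forall s, s \in S -> forall t' t'', (t' < t'' <= T)%N ->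
     opnorm (prodPhi (Phis s) t' t'') <= L * alpha ^+ (t'' - t')) ->
  forall m i v, (m <= stage i)%N ->
    vnorm (transition par_node Phi m i *m v) <= L * alpha ^+ m * vnorm v.
Proof.
(* The assumption covers only [t' < t'']; the empty product is handled by [1 <= L]. *)
move=> L1 PhiE Phi_le [|m] i v; first by rewrite mul1mx expr0 mulr1 ler_peMl ?vnorm_ge0.
have [s [t [sS s0 tT ->]]] := path_nodeP i; rewrite stage_path_node // => mt.
rewrite (transition_path_node sS s0 (fun k => PhiE s k sS s0)) ?mt //.
apply: vnorm_mulmx_le; rewrite -{2}(subKn mt).
by apply: Phi_le => //; rewrite tT andbT ltn_subrL (leq_ltn_trans _ mt).
Qed.

End ScenarioTree.

(** * The Lagrangian in the weighted inner product *)

Section Lagrangian.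
Variables (R : realType) (Xi : choiceType) (nx nu T : nat).
Variables (S : seq (seq Xi)) (mu : seq Xi -> R) (xb0 : Xi).
Hypotheses (S_uniq : uniq S) (S_size : forall s, s \in S -> size s = T.+1).
Hypothesis mu_gt0 : forall s, s \in S -> 0 < mu s.
Hypothesis P0_gt0 : 0 < P0 S mu xb0.
Variables (A Q : Xi -> 'M[R]_nx) (B : Xi -> 'M[R]_(nx, nu)) (Rm : Xi -> 'M[R]_nu).
Variables (d q : Xi -> 'cV[R]_nx) (r : Xi -> 'cV[R]_nu).

Local Notation node := (seq_sub (nodes T S xb0)).
Local Notation wt := (@weight R Xi T S mu xb0).

Definition node_real (i : node) : Xi := realization xb0 (val i).

Definition restrict n (x : seq Xi -> 'cV[R]_n) : {ffun node -> 'cV[R]_n} :=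
  [ffun i : node => x (val i)].

Definition extend n (x : {ffun node -> 'cV[R]_n}) (i : seq Xi) : 'cV[R]_n :=
  if insub i is Some j then x j else 0.

Lemma extendK n : cancel (@extend n) (@restrict n).
Proof. by move=> x; apply/ffunP => i; rewrite ffunE /extend valK. Qed.

(** The constraints away from the root carry the factor [pi i], and the root constraint carries
    none; as the root has weight one, all multipliers end up in the same weighted product. *)
Lemma EP_lagrangianE x u y : EP_lagrangian A B d Q Rm q r T S mu xb0 x u y
  = quadratic_lagrangian wt (root_node S_size P0_gt0) (par_node S_size P0_gt0)
      (A \o node_real) (Q \o node_real) (B \o node_real) (Rm \o node_real)
      (source (fun i => pdata d q r (node_real i)))
      (restrict x, restrict u, restrict y).
Proof.
set rt := root_node _ _; set par := par_node _ _.
have hX := inner_product_vdot R nx; have hU := inner_product_vdot R nu.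
rewrite /EP_lagrangian !sum_nodes -addrA.
pose dyn := dynop rt par (A \o node_real) (B \o node_real) (restrict x, restrict u).
rewrite [X in _ + X](_ : _ = \sum_(i : node) wt i *
    vdot (y (val i)) (dyn i + d (node_real i))); last first.
  rewrite [RHS](bigD1 rt) //=; congr (_ + _).
    rewrite weight_root mul1r; congr vdot.
    by rewrite /dyn /dynop !ffunE eqxx /fdyn !mulmx0 !add0r addrC.
  apply: eq_big => i; first by rewrite -val_eqE.
  rewrite -[_ != _]/(val i != val rt) val_eqE => irt.
  rewrite -scalerBr (ipZr hX) -/(wt i); congr (_ * vdot _ _).
  rewrite /dyn /dynop !ffunE (negbTE irt) /fdyn parent_node //.
  by rewrite addrAC.
rewrite /quadratic_lagrangian quad_kktop; last exact: weight_gt0.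
rewrite /ipZ /ipW /ipX /ipU /fam_ip /= -/dyn.
rewrite !mulr_sumr -!big_split /= mulr_sumr -sumrB; apply: eq_bigr => i _.
rewrite !ffunE /stage_cost /pdata !col_mxKu !col_mxKd /= -/(node_real i) -/(wt i).
rewrite (ipDr hX) (ipNr hX) -[vdot (q _) _](ipC hX) -[vdot (r _) _](ipC hU).
rewrite [vdot (y _) (_ - x _)](ipC hX).
by field.
Qed.

Lemma EP_primal_dual_solE x u y (z := (restrict x, restrict u, restrict y))
    (QL := quadratic_lagrangian wt (root_node S_size P0_gt0) (par_node S_size P0_gt0)
      (A \o node_real) (Q \o node_real) (B \o node_real) (Rm \o node_real)
      (source (fun i => pdata d q r (node_real i)))) :
  EP_primal_dual_sol A B d Q Rm q r T S mu xb0 x u y <->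
  (forall y', QL (z.1, y') <= QL z) /\ (forall w, QL z <= QL (w, z.2)).
Proof.
split=> -[hy hw]; split=> [y'|w].
- by have := hy (extend y'); rewrite !EP_lagrangianE extendK.
- by case: w => x' u'; have := hw (extend x') (extend u'); rewrite !EP_lagrangianE !extendK.
- by rewrite !EP_lagrangianE; apply: hy.
by move=> u'; rewrite !EP_lagrangianE; apply: hw.
Qed.

End Lagrangian.

(** * From families on the tree to the scaled block norms *)

Lemma pinorm_le (R : realType) (I : Type) (pi : I -> R) m k (M : I -> I -> 'M[R]_(m, k))
    (V1 V2 : seq I) (C : R) : 0 <= C ->
  (forall v, \sum_(i <- V1) pi i * vnorm2 (\sum_(j <- V2) M i j *m v j)
             <= C ^+ 2 * \sum_(j <- V2) pi j * vnorm2 (v j)) ->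
  pinorm pi M V1 V2 <= C.
Proof.
move=> C0 M_le; apply: ge_sup => [|_ [v [v1 ->]]].
  exists (fam_norm pi V1 (fun i => \sum_(j <- V2) M i j *m 0)), (fun=> 0); split=> //.
  rewrite /fam_norm big1 ?sqrtr0 ?ler01 // => i _.
  by rewrite [vnorm2 _](ip0l (inner_product_vdot R k)) mulr0.
apply: le_trans (ler_wsqrtr (M_le v)) _.
rewrite sqrtrM ?sqr_ge0 // sqrtr_sqr ger0_norm //.
by rewrite -[leRHS]mulr1 ler_wpM2l.
Qed.


Theorem theoremA1 (R : realType) (Xi : choiceType) (nx nu T : nat)
  (A : Xi -> 'M[R]_nx) (B : Xi -> 'M[R]_(nx, nu)) (d : Xi -> 'cV[R]_nx)
  (Q : Xi -> 'M[R]_nx) (Rm : Xi -> 'M[R]_nu)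
  (q : Xi -> 'cV[R]_nx) (r : Xi -> 'cV[R]_nu)
  (HQsym : forall xi, sym_mx (Q xi)) (HRsym : forall xi, sym_mx (Rm xi))
  (S : seq (seq Xi)) (mu : seq Xi -> R)
  (HSuniq : uniq S) (HSsize : forall s, s \in S -> size s = T.+1)
  (Hmu_pos : forall s, s \in S -> 0 < mu s)
  (Hmu_sum : \sum_(s <- S) mu s = 1)
  (xb0 : Xi) (Hxb0 : 0 < P0 S mu xb0)
  (L alpha gamma : R) (HL : 1 <= L) (Halpha : 0 < alpha < 1) (Hgamma : 0 < gamma <= 1)
  (H2a : forall s, s \in S -> forall t, (t <= T)%N ->
     [/\ opnorm (A (nth xb0 s t)) <= L, opnorm (B (nth xb0 s t)) <= L,
         opnorm (Q (nth xb0 s t)) <= L & opnorm (Rm (nth xb0 s t)) <= L])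
  (H2b : forall s, s \in S -> forall t, (t <= T)%N ->
     psd_ge 0 (Q (nth xb0 s t)) /\ psd_ge gamma (Rm (nth xb0 s t)))
  (H2c : exists K : nat -> seq Xi -> 'M[R]_(nu, nx),
     (forall s, s \in S -> forall t, (t < T)%N -> opnorm (K t (take t.+1 s)) <= L) /\
     (forall s, s \in S -> forall t' t'', (t' < t'' <= T)%N ->
        opnorm (prodPhi (fun t => A (nth xb0 s t) - B (nth xb0 s t) *m K t.-1 (take t s)) t' t'')
          <= L * alpha ^+ (t'' - t')))
  (Qh : Xi -> 'M[R]_nx)
  (HQh : forall s, s \in S -> forall t, (t <= T)%N ->
     [/\ sym_mx (Qh (nth xb0 s t)), psd_ge 0 (Qh (nth xb0 s t))
       & Qh (nth xb0 s t) *m Qh (nth xb0 s t) = Q (nth xb0 s t)])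
  (H2d : exists K' : nat -> seq Xi -> 'M[R]_nx,
     (forall s, s \in S -> forall t, (1 <= t <= T)%N -> opnorm (K' t (take t.+1 s)) <= L) /\
     (forall s, s \in S -> forall t' t'', (t' < t'' <= T)%N ->
        opnorm (prodPhi (fun t => A (nth xb0 s t) - K' t (take t.+1 s) *m Qh (nth xb0 s t.-1)) t' t'')
          <= L * alpha ^+ (t'' - t'))) :
  exists (x : seq Xi -> 'cV[R]_nx) (u : seq Xi -> 'cV[R]_nu) (y : seq Xi -> 'cV[R]_nx),
    EP_primal_dual_sol A B d Q Rm q r T S mu xb0 x u y /\
    (forall x' u' y', EP_primal_dual_sol A B d Q Rm q r T S mu xb0 x' u' y' ->
       forall i, i \in nodes T S xb0 -> [/\ x' i = x i, u' i = u i & y' i = y i]) /\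
    exists (Om : seq Xi -> seq Xi -> 'M[R]_(nx + nu + nx))
           (Ps : seq Xi -> seq Xi -> 'M[R]_(nx + nu, nx + nu + nx)),
      (forall i, i \in nodes T S xb0 ->
         col_mx (col_mx (x i) (u i)) (y i)
           = \sum_(j <- nodes T S xb0) Om i j *m pdata d q r (realization xb0 j)) /\
      (forall i, i \in nodes T S xb0 ->
         col_mx (x i) (u i)
           = \sum_(j <- nodes T S xb0) Ps i j *m pdata d q r (realization xb0 j)) /\
      (forall t t', (t <= T)%N -> (t' <= T)%N ->
         Num.max (pinorm (piN S mu xb0) Om (nodes_at T S xb0 t) (nodes_at T S xb0 t'))
                 (pinorm (piN S mu xb0) Ps (nodes_at T S xb0 t) (nodes_at T S xb0 t'))
           <= c_1 L alpha gamma * rho L alpha gamma ^+ tdist t t').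
Proof.
pose I := seq_sub (nodes T S xb0).
pose rt : I := root_node HSsize Hxb0; pose par := par_node HSsize Hxb0.
pose st := @stage Xi T S xb0; pose pi := @weight R Xi T S mu xb0.
pose xi := @node_real Xi T S xb0.
have nodeP (i : I) : exists s t, [/\ s \in S, head xb0 s = xb0, (t <= T)%N
    & i = path_node HSsize Hxb0 s t] by exact: path_nodeP.
have xiP i : exists s t, [/\ s \in S, (t <= T)%N & xi i = nth xb0 s t].
  have [s [t [sS s0 tT ->]]] := nodeP i; exists s, t; split=> //.
  exact: realization_path_node.
have L0 : 0 <= L by rewrite (le_trans ler01).
have [K [K_le K_stab]] := H2c; have [K' [K'_le K'_det]] := H2d.
(* The feedback is given before stage [T] only, and the injection from stage [1] on; zero fills in
   at the leaves and at the root. The closed loops evaluate [KN] at parents and [KN'] away from the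
   root, so these values never enter the stability products. *)
pose KN (i : I) := if (st i < T)%N then K (st i) (val i) else 0.
pose KN' (i : I) := if i == rt then 0 else K' (st i) (val i).
have mul0_le n (m : nat) (v : 'cV[R]_n) : vnorm ((0 : 'M[R]_(m, n)) *m v) <= L * vnorm v.
  rewrite mul0mx [vnorm 0](ipnorm0 (inner_product_vdot R m)).
  by rewrite mulr_ge0 ?vnorm_ge0.
have A_le i v : vnorm (A (xi i) *m v) <= L * vnorm v.
  have [s [t [sS tT ->]]] := xiP i; have [h _ _ _] := H2a s sS t tT.
  exact: vnorm_mulmx_le.
have B_le i v : vnorm (B (xi i) *m v) <= L * vnorm v.
  have [s [t [sS tT ->]]] := xiP i; have [_ h _ _] := H2a s sS t tT.
  exact: vnorm_mulmx_le.
have Q_le i v : vnorm (Q (xi i) *m v) <= L * vnorm v.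
  have [s [t [sS tT ->]]] := xiP i; have [_ _ h _] := H2a s sS t tT.
  exact: vnorm_mulmx_le.
have R_le i v : vnorm (Rm (xi i) *m v) <= L * vnorm v.
  have [s [t [sS tT ->]]] := xiP i; have [_ _ _ h] := H2a s sS t tT.
  exact: vnorm_mulmx_le.
have R_ge i v : gamma * vnorm2 v <= vdot v (Rm (xi i) *m v).
  by have [s [t [sS tT ->]]] := xiP i; have [_ h] := H2b s sS t tT; apply: h.
have Qh_sym i : (Qh (xi i))^T = Qh (xi i).
  by have [s [t [sS tT ->]]] := xiP i; have [h _ _] := HQh s sS t tT.
have Qh_sqr i : Qh (xi i) *m Qh (xi i) = Q (xi i).
  by have [s [t [sS tT ->]]] := xiP i; have [_ _ h] := HQh s sS t tT.
have KN_le i v : vnorm (KN i *m v) <= L * vnorm v.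
  have [s [t [sS s0 tT ->]]] := nodeP i; rewrite /KN /st stage_path_node //.
  case: ifP => // tT'; rewrite val_path_node //.
  by apply: vnorm_mulmx_le; apply: K_le.
have KN'_le i v : vnorm (KN' i *m v) <= L * vnorm v.
  have [s [t [sS s0 tT ->]]] := nodeP i; rewrite /KN' path_node_eq_root //.
  case: eqP => // /eqP t0; rewrite /st stage_path_node // val_path_node //.
  by apply: vnorm_mulmx_le; apply: K'_le => //; rewrite lt0n t0.
have par_path s t : s \in S -> head xb0 s = xb0 -> (0 < t <= T)%N ->
    par (path_node HSsize Hxb0 s t) = path_node HSsize Hxb0 s t.-1.
  by case: t => // t sS s0 /andP[_ tT]; apply: par_path_node.
have stab m i v : (m <= st i)%N ->
    vnorm (transition par (fun i => A (xi i) - B (xi i) *m KN (par i)) m i *m v)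
    <= L * alpha ^+ m * vnorm v.
  move: m i v; apply: (transition_norm_le HSuniq HL _ K_stab) => s t sS s0 t0T.
  have [t0 tT] := andP t0T; have t1T : (t.-1 < T)%N by rewrite prednK.
  rewrite par_path // /KN /st stage_path_node ?(ltnW t1T) // t1T.
  rewrite val_path_node ?(ltnW t1T) // prednK //.
  by rewrite /xi /node_real realization_path_node.
have det m i v : (m <= st i)%N ->
    vnorm (transition par (fun i => A (xi i) - KN' i *m Qh (xi (par i))) m i *m v)
    <= L * alpha ^+ m * vnorm v.
  move: m i v; apply: (transition_norm_le HSuniq HL _ K'_det) => s t sS s0 t0T.
  have [t0 tT] := andP t0T; have t1T : (t.-1 <= T)%N by apply: leq_trans (leq_pred _) tT.
  rewrite par_path // /KN' path_node_eq_root // gtn_eqF // /st stage_path_node //.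
  by rewrite val_path_node // /xi /node_real !realization_path_node.
have pi_gt0 : forall i, 0 < pi i := weight_gt0 HSuniq HSsize Hmu_pos Hxb0.
have st_par : forall i, i != rt -> st i = (st (par i)).+1 := @stage_par_node _ _ _ _ _ _ _ _.
have pi_children := sum_children_weight HSsize Hmu_pos Hxb0.
pose A_ i := A (xi i); pose Q_ i := Q (xi i); pose B_ i := B (xi i); pose R_ i := Rm (xi i).
pose p_ i := pdata d q r (xi i).
have Q_sym i : (Q_ i)^T = Q_ i := HQsym _.
have R_sym i : (R_ i)^T = R_ i := HRsym _.
have [Om [Om_sol Om_le]] := kktop_green pi_gt0 st_par pi_children HL Halpha Hgamma
  A_le B_le Q_le R_le KN_le KN'_le Q_sym R_sym R_ge Qh_sym Qh_sqr stab det.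
have inj := kktop_inj pi_gt0 st_par pi_children HL Halpha Hgamma
  B_le Q_le R_le KN_le KN'_le R_ge Qh_sym Qh_sqr stab det.
have solE x u y : EP_primal_dual_sol A B d Q Rm q r T S mu xb0 x u y <->
    kktop pi rt par A_ Q_ B_ R_ (restrict T S xb0 x, restrict T S xb0 u, restrict T S xb0 y)
    = source p_.
  apply: (iff_trans (EP_primal_dual_solE HSuniq HSsize Hmu_pos Hxb0 A Q B Rm d q r x u y)).
  exact: (saddle_point_kkt rt par pi_gt0 A_ B_ HL Hgamma
    Q_le R_le Q_sym R_sym R_ge Qh_sym Qh_sqr).
have [z zE zOm] := Om_sol p_.
exists (extend z.1.1), (extend z.1.2), (extend z.2); split.
  by apply/solE; rewrite !extendK -zE; case: z {zE zOm} => [[]].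
have extE n (x : {ffun I -> 'cV[R]_n}) i : extend x (val i) = x i by rewrite /extend valK.
split.
  move=> x' u' y' /solE; rewrite -zE => /inj zE' i iV; have -> : i = val (SeqSub iV) by [].
  by rewrite !extE -zE' /= !ffunE.
pose OmS i j : 'M[R]_(nx + nu + nx) :=
  if insub i is Some i' then if insub j is Some j' then Om i' j' else 0 else 0.
have OmSE (i j : I) : OmS (val i) (val j) = Om i j by rewrite /OmS !valK.
have OmS_sum (i : I) (P : pred (seq Xi)) v :
    \sum_(j <- nodes T S xb0 | P j) OmS (val i) j *m v j
    = \sum_(j : I | P (val j)) Om i j *m v (val j).
  by rewrite sum_nodes; apply: eq_bigr => j _; rewrite OmSE.
have sol_block i : i \in nodes T S xb0 ->
    col_mx (col_mx (extend z.1.1 i) (extend z.1.2 i)) (extend z.2 i)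
    = \sum_(j <- nodes T S xb0) OmS i j *m pdata d q r (realization xb0 j).
  move=> iV; have -> : i = val (SeqSub iV) by [].
  by rewrite OmS_sum !extE -[LHS]/(block _ z) zOm.
have atE t (i : I) : (size (val i) == t.+1) = (st i == t).
  by rewrite /st /stage -(prednK (node_size_gt0 HSsize Hxb0 i)).
have OmS_le t t' v :
    \sum_(i <- nodes_at T S xb0 t) piN S mu xb0 i
      * vnorm2 (\sum_(j <- nodes_at T S xb0 t') OmS i j *m v j)
    <= (c_1 L alpha gamma * rho L alpha gamma ^+ tdist t t') ^+ 2
       * \sum_(j <- nodes_at T S xb0 t') piN S mu xb0 j * vnorm2 (v j).
  rewrite !big_filter !sum_nodes.
  rewrite (eq_bigl _ _ (atE t)) (eq_bigl _ _ (atE t')).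
  have := Om_le t t' (fun j => v (val j)); congr (_ <= _); apply: eq_bigr => i _.
  congr (_ * vnorm2 _); rewrite big_filter OmS_sum.
  exact/esym/eq_bigl/atE.
have C0 t t' : 0 <= c_1 L alpha gamma * rho L alpha gamma ^+ tdist t t'.
  apply: le_trans (decay_rate_le HL Halpha Hgamma _).
  apply: mulr_ge0; first by rewrite exprn_ge0 ?sqr_ge0.
  by rewrite invr_ge0 (ltW (gamma_H_gt0 HL Halpha Hgamma)).
(* [Ps] consists of the rows of [OmS] that produce [x] and [u]; discarding the multiplier rows can
   only decrease the norm. *)
exists OmS, (fun i j => usubmx (OmS i j)); split=> [//|]; split=> [i iV|t t' _ _].
  rewrite -[LHS](col_mxKu _ (extend z.2 i)) sol_block // linear_sum.
  by apply: eq_bigr => j _; rewrite mul_usub_mx.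
rewrite ge_max; apply/andP; split; apply: pinorm_le => // v.
apply: le_trans (OmS_le t t' v); rewrite ![\sum_(i <- nodes_at _ _ _ t) _]big_seq.
apply: ler_sum => i; rewrite mem_filter => /andP[_ iV].
have pi0 : 0 < piN S mu xb0 i by have := pi_gt0 (SeqSub iV).
rewrite ler_pM2l // (eq_bigr (fun j => usubmx (OmS i j *m v j))) => [|j _]; last first.
  by rewrite mul_usub_mx.
rewrite -linear_sum /=; set w := \sum_(_ <- _) _.
by rewrite -[w in leRHS]vsubmxK vnorm2_col_mx lerDl vnorm2_ge0.
Qed.
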